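(* Let $y^{\tilde c}$ be a $\tilde c$-parameter spectral transform of a timelike $(\pm)$-isothermic surface $y:M\to Q^n_r$, and denote by $Y$, $Y^{\tilde c}$ their canonical lifts for the same adapted coordinate $(u,v)$. Let $\psi$ be a non-degenerate $c$-polar surface of $y$. Then there exists a $c$-polar surface $\psi^{\tilde c}$ of $y^{\tilde c}$ such that $\psi^{\tilde c}$ is a $\tilde c$-parameter spectral transform of $\psi$. In other words, the operations of taking $c$-polar surfaces and of taking spectral transforms form a commuting diagram $[Y]\to[Y^{\tilde c}]$, $[Y]\to\psi$, $[Y^{\tilde c}]\to\psi^{\tilde c}$, $\psi\to\psi^{\tilde c}$.
   Context: $\mathbb{R}^m_s$ is $\mathbb{R}^m$ with $\langle x,x\rangle=\sum_{i=1}^{m-s}x_i^2-\sum_{i=m-s+1}^m x_i^2$. Let $n-r\ge2$, $r\ge1$. $Q^n_r$ is the set of points $[x]\in\mathbb{R}P^{n+1}$ with $x\in\mathbb{R}^{n+2}_{r+1}\setminus\{0\}$, $\langle x,x\rangle=0$, with the conformal structure induced by $\langle\,,\rangle$. Surfaces in a projective light cone. A lift of $y:M\to Q^n_r$ is a local map $Y$ into nonzero null vectors with $[Y]=y$. $y$ is timelike if $\langle dY,dY\rangle$ is a Lorentzian metric. Asymptotic coordinates $(u,v)$ satisfy $\langle Y_u,Y_u\rangle=\langle Y_v,Y_v\rangle=0$; the canonical lift satisfies $\langle Y_u,Y_v\rangle=\frac12$ (if $\langle Y_u,Y_v\rangle<0$, one passes to $(u,-v)$; the coordinates $(u,v)$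 and $(u,-v)$ are not distinguished). Put $V=\mathrm{Span}\{Y,Y_u,Y_v,Y_{uv}\}$, $V^\perp$ its orthogonal complement (conformal normal bundle), $D$ the normal connection on $V^\perp$. The conformal Hopf differentials $\kappa_1,\kappa_2\in\Gamma(V^\perp)$ and Schwarzians $s_1,s_2$ are defined by $Y_{uu}=-\frac{s_1}{2}Y+\kappa_1$, $Y_{vv}=-\frac{s_2}{2}Y+\kappa_2$. $y$ is timelike $(\pm)$-isothermic if around each point there are asymptotic coordinates with $\kappa_1=\pm\kappa_2$ (adapted coordinates). The same definitions apply in the projective light cone of any nondegenerate indefinite inner product space. $c$-polar surfaces. A $c$-polar transform (or $c$-polar surface) of $y$ is a section $\psi\in\Gamma(V^\perp)$ with $D_u\psi=D_v\psi=0$ and $\langle\psi,\psi\rangle=c$ constant; for $c\ne0$ it is regarded as a map into $P_c=\{x\in\mathbb{R}^{n+2}_{r+1}:\langle x,x\rangle=c\}$, for $c=0$ as the map $[\psi]$ into $Q^n_r$. It is non-degenerate if it is an immersion, i.e. $\langle\psi,\kappa_1\rangle\ne0$. For $c\neq 0$ the conformal invariants and transforms of a surface $x$ in $P_c$ are those of $[(x,1)]$ in the projective light cone of $\mathbb{R}^{n+2}_{r+1}\oplus\mathbb{R}$ with quadratic form $\langle x,x\rangle-ct^2$. Spectral transforms. Let $\tilde c\in\mathbb{R}$. Given a timelike $(\pm)$-isothermic surface with adapted coordinate $(u,v)$ and invariants $\kappa_i,s_i,D$, a $\tilde c$-parameter spectral transform of it is a timelike surface in the same projective light cone, with the same coordinate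 $(u,v)$, whose normal bundle is identified by a fibrewise isometry $\phi\mapsto\phi^{\tilde c}$ with the original normal bundle so that the normal connections and Hopf differentials correspond ($D^{\tilde c}=D$, $\langle\kappa_i^{\tilde c},\phi^{\tilde c}\rangle=\langle\kappa_i,\phi\rangle$), and whose Schwarzians are $s_1^{\tilde c}=s_1+\tilde c$, $s_2^{\tilde c}=s_2+\tilde c$ in the $(+)$ case, and $s_1^{\tilde c}=s_1+\tilde c$, $s_2^{\tilde c}=s_2-\tilde c$ in the $(-)$ case. *)

(* Defs.v *)
From HB Require Import structures.
From mathcomp Require Import all_boot all_order all_algebra.
From mathcomp Require Import all_classical all_reals all_analysis.
From mathcomp Require Import ring.

Set Implicit Arguments.
Unset Strict Implicit.
Unset Printing Implicit Defensive.

Import Order.TTheory GRing.Theory Num.Theory.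
Import numFieldNormedType.Exports.

Local Open Scope classical_set_scope.
Local Open Scope ring_scope.

(* Throughout, an inner product space is 'rV[R]_m equipped with a symmetric
   bilinear form B : {symmetric 'rV[R]_m}. *)

Section StandardForm.
Variables (R : realType) (m s : nat).

(* The inner product of R^m_s. *)
Definition std_form (x y : 'rV[R]_m) : R :=
  \sum_(i < m) (if (i < m - s)%N then 1 else -1) * (x 0 i * y 0 i).

Fact std_form_bilinear : bilinear_for
  (GRing.Scale.Law.clone _ _ *%R _)
  (GRing.Scale.Law.clone _ _ (idfun \; *%R) _) std_form.
Proof.
by split=> z k x y; rewrite /std_form /= mulr_sumr -big_split /=;
  apply: eq_bigr => i _; rewrite !mxE; ring.
Qed.

HB.instance Definition _ := bilinear_isBilinear.Build R
  'rV[R]_m 'rV[R]_m R _ _ std_form std_form_bilinear.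

Fact std_form_hermitian (x y : 'rV[R]_m) :
  std_form x y = (-1) ^+ false * idfun (std_form y x).
Proof.
by rewrite expr0 mul1r; apply: eq_bigr => i _; rewrite [x 0 i * _]mulrC.
Qed.

HB.instance Definition _ := isHermitianSesquilinear.Build R
  'rV[R]_m false idfun std_form std_form_hermitian.

End StandardForm.

Section ExtendedForm.
Variables (R : realType) (m : nat) (B : {symmetric 'rV[R]_m}) (c : R).

(* The form <x, x> - c t^2 on 'rV[R]_m (+) R, polarised. *)
Definition ext_form (x y : 'rV[R]_(m + 1)) : R :=
  B (lsubmx x) (lsubmx y) - c * (rsubmx x 0 0 * rsubmx y 0 0).

Fact ext_form_bilinear : bilinear_for
  (GRing.Scale.Law.clone _ _ *%R _)
  (GRing.Scale.Law.clone _ _ (idfun \; *%R) _) ext_form.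
Proof.
by split=> z k x y; rewrite /ext_form !linearP ?linearPl ?linearPr /= !mxE;
  ring.
Qed.

HB.instance Definition _ := bilinear_isBilinear.Build R
  'rV[R]_(m + 1) 'rV[R]_(m + 1) R _ _ ext_form ext_form_bilinear.

Fact ext_form_hermitian (x y : 'rV[R]_(m + 1)) :
  ext_form x y = (-1) ^+ false * idfun (ext_form y x).
Proof.
rewrite expr0 mul1r /ext_form /= hermC expr0 mul1r /=.
by rewrite [rsubmx x 0 0 * _]mulrC.
Qed.

HB.instance Definition _ := isHermitianSesquilinear.Build R
  'rV[R]_(m + 1) false idfun ext_form ext_form_hermitian.

End ExtendedForm.

Section PlaneCalculus.
Variables (R : realType) (W : normedModType R).

Definition partial_u (f : R * R -> W) (p : R * R) : W := 'D_((1, 0) : R * R) f p.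
Definition partial_v (f : R * R -> W) (p : R * R) : W := 'D_((0, 1) : R * R) f p.

Fixpoint classC (k : nat) (U : set (R * R)) (f : R * R -> W) : Prop :=
  (forall p, U p -> {for p, continuous f}) /\
  if k is k'.+1 then
    [/\ forall p, U p -> derivable f p (1, 0) /\ derivable f p (0, 1),
        classC k' U (partial_u f) & classC k' U (partial_v f)]
  else True.

Definition smooth_on (U : set (R * R)) (f : R * R -> W) : Prop :=
  forall k, classC k U f.

End PlaneCalculus.

(* A surface is given in its coordinates (u, v) on an open set U of R^2 as a map
   y into lines of 'rV[R]_m, the point [x] of the projective space being the
   line <[x]>%VS. The values of all maps outside U are irrelevant. *)
Section Surfaces.
Variables (R : realType) (m : nat) (B : {symmetric 'rV[R]_m}).
Variable U : set (R * R).
Implicit Types (y : R * R -> {vspace 'rV[R]_m}) (Y : R * R -> 'rV[R]_m).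

Definition is_lift (W : set (R * R)) y Y : Prop :=
  smooth_on W Y /\
  forall p, W p -> [/\ Y p != 0, B (Y p) (Y p) = 0 & y p = <[Y p]>%VS].

Definition differential Y (p a : R * R) : 'rV[R]_m :=
  a.1 *: partial_u Y p + a.2 *: partial_v Y p.

Definition induced_metric Y (p a b : R * R) : R :=
  B (differential Y p a) (differential Y p b).

(* signature (1, 1), through an orthonormal basis of the tangent plane *)
Definition lorentzian (g : R * R -> R * R -> R) : Prop :=
  exists a b, [/\ g a a = 1, g b b = -1 & g a b = 0].

Definition timelike y : Prop :=
  forall p, U p -> exists (W : set (R * R)) Y,
    [/\ open W, W p, W `<=` U, is_lift W y Y &
        forall q, W q -> lorentzian (induced_metric Y q)].

Definition canonical_lift y Y : Prop :=
  is_lift U y Y /\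
  forall p, U p ->
    [/\ B (partial_u Y p) (partial_u Y p) = 0,
        B (partial_v Y p) (partial_v Y p) = 0 &
        B (partial_u Y p) (partial_v Y p) = 2^-1].

Definition conf_tangent Y (p : R * R) : {vspace 'rV[R]_m} :=
  <<[:: Y p; partial_u Y p; partial_v Y p; partial_u (partial_v Y) p]>>%VS.

Definition conf_normal Y (p : R * R) : {vspace 'rV[R]_m} :=
  orthov B (conf_tangent Y p).

(* smooth sections of the conformal normal bundle over U *)
Definition normal_section Y (phi : R * R -> 'rV[R]_m) : Prop :=
  smooth_on U phi /\ forall p, U p -> phi p \in conf_normal Y p.

(* The normal connection: projection onto the conformal normal space along
   its orthogonal complement. *)
Definition normal_proj Y (p : R * R) : 'End('rV[R]_m) :=
  daddv_pi (conf_normal Y p) (conf_tangent Y p).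

Definition D_u Y (phi : R * R -> 'rV[R]_m) (p : R * R) : 'rV[R]_m :=
  normal_proj Y p (partial_u phi p).

Definition D_v Y (phi : R * R -> 'rV[R]_m) (p : R * R) : 'rV[R]_m :=
  normal_proj Y p (partial_v phi p).

Definition conf_invariants Y (kappa1 kappa2 : R * R -> 'rV[R]_m)
    (s1 s2 : R * R -> R) : Prop :=
  forall p, U p ->
    [/\ kappa1 p \in conf_normal Y p, kappa2 p \in conf_normal Y p,
        partial_u (partial_u Y) p = - (s1 p / 2) *: Y p + kappa1 p &
        partial_v (partial_v Y) p = - (s2 p / 2) *: Y p + kappa2 p].

(* (u, v) are adapted coordinates: kappa1 = kappa2 in the (+) case
   (minus = false), kappa1 = - kappa2 in the (-) case (minus = true). *)
Definition adapted (minus : bool) (kappa1 kappa2 : R * R -> 'rV[R]_m) : Prop :=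
  forall p, U p -> kappa1 p = (-1) ^+ minus *: kappa2 p.

(* A smooth fibrewise isometry of the normal bundle of Y onto that of Yt which
   intertwines the normal connections; Phi p is only relevant on the normal
   space of Y at p. *)
Definition parallel_isometry Y Yt (Phi : R * R -> 'End('rV[R]_m)) : Prop :=
  (forall p, U p ->
     (Phi p @: conf_normal Y p)%VS = conf_normal Yt p /\
     {in conf_normal Y p &, forall x x', B (Phi p x) (Phi p x') = B x x'}) /\
  (forall phi, normal_section Y phi ->
     let phit := fun q => Phi q (phi q) in
     smooth_on U phit /\
     forall p, U p -> D_u Yt phit p = Phi p (D_u Y phi p) /\
                      D_v Yt phit p = Phi p (D_v Y phi p)).

(* y is a timelike (+-)-isothermic surface with adapted coordinates (u, v), yt
   is a ct-parameter spectral transform of it, and Y, Yt are their canonical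
   lifts. *)
Definition spectral_lifts (minus : bool) (ct : R) y yt Y Yt : Prop :=
  [/\ timelike y, timelike yt, canonical_lift y Y, canonical_lift yt Yt &
  exists kappa1 kappa2 s1 s2 kappa1t kappa2t s1t s2t,
    [/\ conf_invariants Y kappa1 kappa2 s1 s2, adapted minus kappa1 kappa2,
        conf_invariants Yt kappa1t kappa2t s1t s2t,
        forall p, U p -> s1t p = s1 p + ct /\ s2t p = s2 p + (-1) ^+ minus * ct &
        exists2 Phi, parallel_isometry Y Yt Phi &
          forall p, U p -> {in conf_normal Y p, forall phi,
            B (kappa1t p) (Phi p phi) = B (kappa1 p) phi /\
            B (kappa2t p) (Phi p phi) = B (kappa2 p) phi}]].

Definition polar_surface (c : R) Y (psi : R * R -> 'rV[R]_m) : Prop :=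
  normal_section Y psi /\
  forall p, U p -> [/\ D_u Y psi p = 0, D_v Y psi p = 0 & B (psi p) (psi p) = c].

(* Immersion: of psi into {<x, x> = c} if c != 0, of [psi] into the projective
   light cone if c = 0. *)
Definition nondegenerate_polar (c : R) (psi : R * R -> 'rV[R]_m) : Prop :=
  forall p, U p ->
    if c == 0 then free [:: psi p; partial_u psi p; partial_v psi p]
    else free [:: partial_u psi p; partial_v psi p].

End Surfaces.

Definition reflect_v (R : realType) (p : R * R) : R * R := (p.1, - p.2).

(* The coordinates may be (u, v) or (u, -v), simultaneously for y and yt. *)
Definition spectral_transform (R : realType) (m : nat)
    (B : {symmetric 'rV[R]_m}) (U : set (R * R)) (minus : bool) (ct : R)
    (y yt : R * R -> {vspace 'rV[R]_m}) : Prop :=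
  (exists Y Yt, spectral_lifts B U minus ct y yt Y Yt) \/
  (exists Y Yt, spectral_lifts B (@reflect_v R @^-1` U) minus ct
                  (y \o @reflect_v R) (yt \o @reflect_v R) Y Yt).

Definition proj_map (R : realType) (m : nat) (X : R * R -> 'rV[R]_m) :
  R * R -> {vspace 'rV[R]_m} := fun p => <[X p]>%VS.

(* For c != 0 the surface psi is replaced by [(psi, 1)]. *)
Definition polar_spectral_transform (R : realType) (m : nat)
    (B : {symmetric 'rV[R]_m}) (U : set (R * R)) (minus : bool) (ct c : R)
    (psi psit : R * R -> 'rV[R]_m) : Prop :=
  if c == 0 then spectral_transform B U minus ct (proj_map psi) (proj_map psit)
  else spectral_transform (ext_form B c) U minus ct
         (proj_map (fun p => row_mx (psi p) 1)) (proj_map (fun p => row_mx (psit p) 1)).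

(* Main.v *)
Require Import Defs.
From HB Require Import structures.
From mathcomp Require Import all_boot all_order all_algebra.
From mathcomp Require Import all_classical all_reals all_analysis.
From mathcomp Require Import ring lra.

Set Implicit Arguments.
Unset Strict Implicit.
Unset Printing Implicit Defensive.

Import Order.TTheory GRing.Theory Num.Theory.
Import numFieldNormedType.Exports.
Local Open Scope classical_set_scope.
Local Open Scope ring_scope.

(** Write [e] for the sign [+1] or [-1] of the isothermic case, [kappa_i] for the
    Hopf differentials, and consider the rotations
    [A_u x = <x, Y_v> Y - <x, Y> Y_v] and [A_v x = <x, Y_u> Y - <x, Y> Y_u].

    The isometry of normal bundles that belongs to a spectral transform, together
    with the correspondence of the frames [Y, Y_u, Y_v, Y_uv] of the two canonical
    lifts, is at each point a linear isometry [L] of the ambient space. The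
    structure equations of the two surfaces differ only by the constants added to
    the Schwarzians, and this amounts to
    [L^-1 d L = d - ct (A_u du + e A_v dv)]: passing to a spectral transform is a
    gauge transformation ([spectral_gaugeP]).

    A polar surface [psi] of [Y] is orthogonal to the frame and parallel, so that
    with [f = <psi, kappa_1>] one has [psi_u = 2 (f_v Y - f Y_v)] and
    [psi_v = 2 e (f_u Y - f Y_u)] ([polar_derivative]); non-degeneracy is [f <> 0].
    Suppose that [psi] is null. The lift [X = psi / (2 f)] satisfies
    [<X_u, X_v> = e / 2], and [X_uu] and [e X_vv] are equal modulo [X], to a vector
    [k] normal to [X, X_u, X_v, X_uv] with [<k, Y> = 1/2] ([polar_lift_exists]).
    Hence [[psi]] is isothermic of the same kind. For [e = -1] its canonical
    coordinates are [(u, - v)], and the last step reflects [v].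

    The rotations annihilate [X], and they annihilate [X_u] and [X_v] in their own
    directions; so [Xt = L X] satisfies [Xt_i = L X_i] and [Xt_ii = L X_ii], while
    [Xt_uv] differs from [L X_uv] by a multiple of [Yt]. The map
    [w |-> L w + ct <w, Y> Xt] makes up for this: it is a parallel isometry from
    the normal bundle of [X] to that of [Xt] ([Phi_parallel]). It takes the Hopf
    differentials to each other, and since [<k, Y> = 1/2] its correction term is
    what moves the Schwarzians by [ct] and [e ct] ([gauged_invariants]). As
    [L psi] is the image of [psi] under the isometry of normal bundles of [Y], it
    is the polar surface sought.

    If [<psi, psi> = c] is not zero, the same argument applies to [(Y, 0)],
    [(psi, 1)] and [L] extended by the identity in the space with form
    [<x, x> - c t^2], where [(psi, 1)] is null ([null_polar_emb],
    [gauge_emb]). *)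

(** * Calculus in the coordinate plane *)

(** [i = true] is the direction of [u] and [i = false] that of [v]; the
    surfaces below are treated symmetrically in the two directions. *)
Definition dir (R : realType) (i : bool) : R * R :=
  if i then (1, 0) else (0, 1).

(** Locked, so that unification compares derivatives by their arguments instead
    of unfolding them to limits of difference quotients. *)
HB.lock Definition partial (R : realType) (W : normedModType R) (i : bool)
    (f : R * R -> W) (p : R * R) : W := 'D_(dir R i) f p.

Lemma partial_derive (R : realType) (W : normedModType R) i (f : R * R -> W) :
  partial i f = 'D_(dir R i) f.
Proof. by rewrite partial.unlock. Qed.

Lemma partial_uE (R : realType) (W : normedModType R) :
  @partial_u R W = partial true.
Proof. by rewrite partial.unlock. Qed.

Lemma partial_vE (R : realType) (W : normedModType R) :
  @partial_v R W = partial false.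
Proof. by rewrite partial.unlock. Qed.

Definition cont_bilinear (R : realType) (V1 V2 V3 : normedModType R)
    (b : V1 -> V2 -> V3) : Prop :=
  [/\ forall y, linear (b ^~ y), forall x, linear (b x) &
      continuous (fun z : V1 * V2 => b z.1 z.2)].

Section DirectionalDerivative.
Variables (R : realType) (V : normedModType R).

(** The product rule for all the pairings used below: scalar multiplication,
    inner products and, with a constant scalar factor, linear maps. *)
Lemma is_derive_bilinear (V1 V2 V3 : normedModType R) (b : V1 -> V2 -> V3)
    (f : V -> V1) (g : V -> V2) (x v : V) (df : V1) (dg : V2) :
  cont_bilinear b -> is_derive x v f df -> is_derive x v g dg ->
  is_derive x v (fun y => b (f y) (g y)) (b df (g x) + b (f x) dg).
Proof.
move=> [bl br bc] [fx <-] [gx <-].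
have blB y x1 x2 : b (x1 - x2) y = b x1 y - b x2 y.
  by rewrite addrC -scaleN1r bl scaleN1r addrC.
have brB y x1 x2 : b y (x1 - x2) = b y x1 - b y x2.
  by rewrite addrC -scaleN1r br scaleN1r addrC.
have b0 y : b 0 y = 0 by rewrite -(subrr 0) blB subrr.
have b0r y : b y 0 = 0 by rewrite -(subrr 0) brB subrr.
have blZ k y z : b (k *: y) z = k *: b y z.
  by have := bl z k y 0; rewrite b0 !addr0.
have brZ k y z : b y (k *: z) = k *: b y z.
  by have := br y k z 0; rewrite b0r !addr0.
suff H : (fun h => h^-1 *: (((fun y => b (f y) (g y)) \o shift x) (h *: v)
    - b (f x) (g x))) @ 0^' --> b ('D_v f x) (g x) + b (f x) ('D_v g x).
  by apply: DeriveDef; [apply/cvg_ex; eexists; exact: H | exact: cvg_lim H].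
(* Along the line through [x] in direction [v], [g] is continuous at [x]. *)
have cg : g (h *: v + x) @[h --> 0^'] --> g x.
  suff : {for 0, continuous (fun h : R => g (h *: v + x))}.
    by move=> /continuous_withinNx; rewrite scale0r add0r.
  exact/differentiable_continuous/derivable1_diffP/(derivable1P _ _ _).1.
have -> : (fun h => h^-1 *: (((fun y => b (f y) (g y)) \o shift x) (h *: v)
    - b (f x) (g x))) =
  (fun h : R => b (h^-1 *: (f (h *: v + x) - f x)) (g (h *: v + x)) +
     b (f x) (h^-1 *: (g (h *: v + x) - g x))).
  apply/funext => h /=.
  by rewrite blZ brZ blB brB -scalerDr addrA subrK.
by apply: cvgD; apply: cvg_comp2 (bc (_, _)) => //=; exact: cvg_cst.
Qed.

End DirectionalDerivative.

Section SmoothMaps.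
Variables (R : realType) (U : set (R * R)).
Hypothesis hU : open U.
Implicit Types (W : normedModType R) (i : bool).

Lemma classCS W k (f : R * R -> W) :
  classC k.+1 U f <->
  (forall p, U p -> {for p, continuous f}) /\
  forall i, (forall p, U p -> derivable f p (dir R i)) /\
            classC k U (partial i f).
Proof.
rewrite /= partial_uE partial_vE; split=> [[cf [df fu fv]]|[cf df]].
  by split=> // -[]; split=> // p /df [].
have [du fu] := df true; have [dv fv] := df false.
by split=> //; split=> // p Up; split; [exact: du|exact: dv].
Qed.

Lemma classC_cont W k (f : R * R -> W) :
  classC k U f -> forall p, U p -> {for p, continuous f}.
Proof. by case: k => [|k] []. Qed.

Lemma classC_lower W k (f : R * R -> W) : classC k.+1 U f -> classC k U f.
Proof.
elim: k f => [f|k IH f] /classCS [cf df]; first by [].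
apply/classCS; split=> // i; have [di pi] := df i; split=> //; exact: IH.
Qed.

Lemma near_open (P : R * R -> Prop) p :
  U p -> (forall q, U q -> P q) -> \near p, P p.
Proof. by move=> Up H; apply: filterS H _; exact: open_nbhs_nbhs. Qed.

Lemma eq_partial W i (f g : R * R -> W) p :
  U p -> (forall q, U q -> f q = g q) -> partial i f p = partial i g p.
Proof.
move=> Up fg; rewrite !partial_derive.
by apply: near_eq_derive; exact: near_open.
Qed.

Lemma eq_classC W k (f g : R * R -> W) :
  (forall q, U q -> f q = g q) -> classC k U f -> classC k U g.
Proof.
elim: k f g => [|k IH] f g fg.
  move=> [cf _]; split=> // p Up.
  have nfg : \near p, f p = g p by exact: near_open.
  rewrite /prop_for /continuous_at -(fg p Up).
  by apply: cvg_trans (cf p Up); exact: near_eq_cvg.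
have ngf p : U p -> {near p, f =1 g} by move=> Up; exact: near_open.
move=> Cf; have := Cf => /classCS [cf df]; apply/classCS; split.
  move=> p Up; rewrite /prop_for /continuous_at -(fg p Up).
  by apply: cvg_trans (cf p Up); apply: near_eq_cvg; exact: ngf.
move=> i; have [di pi] := df i; split.
  by move=> p Up; apply: near_eq_derivable (ngf p Up) (di p Up).
by apply: IH pi => q Uq; exact: eq_partial.
Qed.

Lemma eq_smooth W (f g : R * R -> W) :
  (forall q, U q -> f q = g q) -> smooth_on U f -> smooth_on U g.
Proof. by move=> fg sf k; exact: eq_classC (sf k). Qed.

Lemma smooth_partial W i (f : R * R -> W) :
  smooth_on U f -> smooth_on U (partial i f).
Proof. by move=> sf k; have /classCS [_ /(_ i) []] := sf k.+1. Qed.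

Lemma smooth_cont W (f : R * R -> W) p :
  smooth_on U f -> U p -> {for p, continuous f}.
Proof. by move=> /(_ 0)/classC_cont; apply. Qed.

Lemma is_partial W i (f : R * R -> W) p :
  smooth_on U f -> U p -> is_derive p (dir R i) f (partial i f p).
Proof.
move=> /(_ 1)/classCS [_ /(_ i) [df _]] Up.
by rewrite partial_derive; apply: derivableP; exact: df.
Qed.

Lemma partialE W i (f g : R * R -> W) p :
  (forall q, U q -> is_derive q (dir R i) f (g q)) -> U p -> partial i f p = g p.
Proof.
move=> H Up; rewrite partial_derive.
exact: (@derive_val _ _ _ _ _ _ _ (H p Up)).
Qed.

Lemma smooth_cst W (c : W) : smooth_on U (fun=> c).
Proof.
move=> k; elim: k c => [|k IH] c; first by split=> // p _; exact: cvg_cst.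
apply/classCS; split=> [p _|i]; first exact: cvg_cst.
split=> [p _|]; first exact: derivable_cst.
by apply: eq_classC (IH 0) => q _; rewrite partial_derive derive_cst.
Qed.

Lemma classCD W k (f g : R * R -> W) :
  classC k U f -> classC k U g -> classC k U (fun q => f q + g q).
Proof.
have cD h1 h2 : (forall p, U p -> {for p, continuous h1}) ->
    (forall p, U p -> {for p, continuous h2}) ->
    forall p, U p -> {for p, continuous (fun q => h1 q + h2 q : W)}.
  by move=> c1 c2 p Up; apply: cvgD; [exact: c1|exact: c2].
elim: k f g => [|k IH] f g; first by move=> [cf _] [cg _]; split=> //; exact: cD.
move=> /classCS [cf df] /classCS [cg dg]; apply/classCS; split; first exact: cD.
move=> i; have [di pi] := df i; have [ei qi] := dg i; split.
  by move=> p Up; apply: derivableD; [exact: di|exact: ei].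
apply: eq_classC (IH _ _ pi qi) => q Uq.
by rewrite !partial_derive deriveD//; [exact: di|exact: ei].
Qed.

Lemma classC_bilinear (V1 V2 V3 : normedModType R) (b : V1 -> V2 -> V3) k
    (f : R * R -> V1) (g : R * R -> V2) :
  cont_bilinear b -> classC k U f -> classC k U g ->
  classC k U (fun q => b (f q) (g q)).
Proof.
move=> hb; have [_ _ bc] := hb.
have cB h1 h2 : (forall p, U p -> {for p, continuous h1}) ->
    (forall p, U p -> {for p, continuous h2}) ->
    forall p, U p -> {for p, continuous (fun q => b (h1 q) (h2 q))}.
  move=> c1 c2 p Up; apply: cvg_comp2 (bc (_, _)) => /=; [exact: c1|exact: c2].
elim: k f g => [|k IH] f g; first by move=> [cf _] [cg _]; split=> //; exact: cB.
move=> Cf Cg; have := Cf => /classCS [cf df]; have := Cg => /classCS [cg dg].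
apply/classCS; split; first exact: cB.
move=> i; have [di pi] := df i; have [ei qi] := dg i.
have H p : U p -> is_derive p (dir R i) (fun q => b (f q) (g q))
    (b (partial i f p) (g p) + b (f p) (partial i g p)).
  move=> Up; rewrite !partial_derive; apply: is_derive_bilinear => //;
    apply: derivableP; [exact: di|exact: ei].
split=> [p Up|]; first exact: (@ex_derive _ _ _ _ _ _ _ (H p Up)).
apply: (@eq_classC _ _ (fun p =>
    b (partial i f p) (g p) + b (f p) (partial i g p))).
  by move=> q Uq; rewrite (partialE H).
by apply: classCD; apply: IH => //; exact: classC_lower.
Qed.

Lemma smoothD W (f g : R * R -> W) :
  smooth_on U f -> smooth_on U g -> smooth_on U (fun q => f q + g q).
Proof. by move=> sf sg k; exact: classCD. Qed.

Lemma smooth_bilinear (V1 V2 V3 : normedModType R) (b : V1 -> V2 -> V3)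
    (f : R * R -> V1) (g : R * R -> V2) :
  cont_bilinear b -> smooth_on U f -> smooth_on U g ->
  smooth_on U (fun q => b (f q) (g q)).
Proof. by move=> hb sf sg k; exact: classC_bilinear. Qed.

Lemma partial_bilinear (V1 V2 V3 : normedModType R) (b : V1 -> V2 -> V3) i
    (f : R * R -> V1) (g : R * R -> V2) p :
  cont_bilinear b -> smooth_on U f -> smooth_on U g -> U p ->
  partial i (fun q => b (f q) (g q)) p =
  b (partial i f p) (g p) + b (f p) (partial i g p).
Proof.
move=> hb sf sg Up; rewrite partial_derive.
apply: (@derive_val _ _ _ _ _ _ _ _).
by apply: is_derive_bilinear => //; exact: is_partial.
Qed.

Lemma partialD W i (f g : R * R -> W) p :
  smooth_on U f -> smooth_on U g -> U p ->
  partial i (fun q => f q + g q) p = partial i f p + partial i g p.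
Proof.
move=> sf sg Up; have [? _] := is_partial i sf Up.
by have [? _] := is_partial i sg Up; rewrite !partial_derive; exact: deriveD.
Qed.

Lemma partial_cst W i (c : W) p : partial i (fun=> c) p = 0.
Proof. by rewrite partial_derive; exact: derive_cst. Qed.

Lemma cont_bilinear_scale W : cont_bilinear (fun (k : R) (x : W) => k *: x).
Proof.
split=> [y k a b|x k a b|]; last exact: scale_continuous.
  by rewrite scalerDl -scalerA.
by rewrite scalerDr !scalerA mulrC.
Qed.

Lemma smoothZ W (f : R * R -> R) (g : R * R -> W) :
  smooth_on U f -> smooth_on U g -> smooth_on U (fun q => f q *: g q).
Proof. exact/smooth_bilinear/cont_bilinear_scale. Qed.

Lemma partialZ W i (f : R * R -> R) (g : R * R -> W) p :
  smooth_on U f -> smooth_on U g -> U p ->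
  partial i (fun q => f q *: g q) p =
  partial i f p *: g p + f p *: partial i g p.
Proof. exact/partial_bilinear/cont_bilinear_scale. Qed.

Lemma smoothN W (f : R * R -> W) : smooth_on U f -> smooth_on U (fun q => - f q).
Proof.
move=> sf; apply: (@eq_smooth _ (fun q => (-1) *: f q)).
  by move=> q _; rewrite scaleN1r.
by apply: smoothZ => //; exact: smooth_cst.
Qed.

Lemma partialN W i (f : R * R -> W) p :
  smooth_on U f -> U p -> partial i (fun q => - f q) p = - partial i f p.
Proof.
move=> sf Up; have [? _] := is_partial i sf Up.
by rewrite !partial_derive; exact: deriveN.
Qed.

Lemma smoothM (f g : R * R -> R) :
  smooth_on U f -> smooth_on U g -> smooth_on U (fun q => f q * g q).
Proof. exact: smoothZ. Qed.

Lemma partialM i (f g : R * R -> R) p :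
  smooth_on U f -> smooth_on U g -> U p ->
  partial i (fun q => f q * g q) p = partial i f p * g p + f p * partial i g p.
Proof. exact: partialZ. Qed.

Lemma classCV k (f : R * R -> R) :
  (forall p, U p -> f p != 0) -> classC k U f -> classC k U (fun q => (f q)^-1).
Proof.
move=> f0; have cV : (forall p, U p -> {for p, continuous f}) ->
    forall p, U p -> {for p, continuous (fun q => (f q)^-1)}.
  by move=> c1 p Up; apply: cvgV; [exact: f0|exact: c1].
elim: k => [|k IH]; first by move=> [cf _]; split=> //; exact: cV.
move=> Cf; have := Cf => /classCS [cf df]; apply/classCS; split; first exact: cV.
move=> i; have [di pi] := df i; split.
  by move=> p Up; apply: derivableV; [exact: f0|exact: di].
apply: (@eq_classC _ _ (fun p => - ((f p)^-1 * (f p)^-1) * partial i f p)).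
  move=> q Uq; rewrite !partial_derive deriveV; [|exact: f0|exact: di].
  by rewrite /GRing.scale /= expr2 invfM.
have IV := IH (classC_lower Cf).
apply: (classC_bilinear (cont_bilinear_scale _)) pi.
apply: (@eq_classC _ _ (fun p => (-1) *: ((f p)^-1 *: (f p)^-1))).
  by move=> q _; rewrite scaleN1r.
apply: (classC_bilinear (cont_bilinear_scale _)); first exact: smooth_cst.
exact: (classC_bilinear (cont_bilinear_scale _)).
Qed.

Lemma smoothV (f : R * R -> R) :
  (forall p, U p -> f p != 0) -> smooth_on U f ->
  smooth_on U (fun q => (f q)^-1).
Proof. by move=> f0 sf k; exact: classCV. Qed.

Lemma partialV i (f : R * R -> R) p :
  (forall p, U p -> f p != 0) -> smooth_on U f -> U p ->
  partial i (fun q => (f q)^-1) p = - (f p) ^- 2 * partial i f p.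
Proof.
move=> f0 sf Up; have [? _] := is_partial i sf Up.
by rewrite !partial_derive; apply: deriveV => //; exact: f0.
Qed.

End SmoothMaps.

Section MixedPartials.
Variable R : realType.

Lemma is_derive_line (V : normedModType R) (g : V -> R) (x v : V) (s : R) :
  derivable g (s *: v + x) v ->
  is_derive s 1 (fun t : R => g (t *: v + x)) ('D_v g (s *: v + x)).
Proof.
move=> dg.
suff E : (fun h : R => h^-1 *: (((fun t : R => g (t *: v + x)) \o shift s)
   (h *: 1) - g (s *: v + x))) =
  (fun h => h^-1 *: ((g \o shift (s *: v + x)) (h *: v) - g (s *: v + x))).
  by apply: DeriveDef; rewrite /derivable /derive E.
by apply/funext => h /=; rewrite [_%:A]mulr1 scalerDl addrA.
Qed.

(** Two applications of the mean value theorem; the left-hand side is symmetric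
    in [e1] and [e2], whence the symmetry of second derivatives. *)
Lemma second_difference (V : normedModType R) (g : V -> R) (p e1 e2 : V)
    (h : R) (Q := fun s t : R => s *: e1 + (t *: e2 + p)) :
  0 < h ->
  (forall s t, 0 <= s <= h -> 0 <= t <= h ->
     derivable g (Q s t) e1 /\ derivable ('D_e1 g) (Q s t) e2) ->
  exists s t, [/\ 0 <= s <= h, 0 <= t <= h &
    g (h *: e1 + (h *: e2 + p)) - g (h *: e1 + p) - g (h *: e2 + p) + g p =
    'D_e2 ('D_e1 g) (Q s t) * h * h].
Proof.
move=> h0 dg.
have hh : 0 <= h <= h by apply/andP; split; [exact: ltW|exact: lexx].
have h00 : 0 <= (0 : R) <= h by apply/andP; split; [exact: lexx|exact: ltW].
have Q0 s : Q s 0 = s *: e1 + p by rewrite /Q scale0r add0r.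
have d1 s t : 0 <= s <= h -> 0 <= t <= h ->
    is_derive s 1 (fun s' : R => g (Q s' t)) ('D_e1 g (Q s t)).
  by move=> hs ht; apply: is_derive_line; have [] := dg s t hs ht.
pose phi s := g (Q s h) - g (Q s 0).
have dphi s : 0 <= s <= h ->
    is_derive s 1 phi ('D_e1 g (Q s h) - 'D_e1 g (Q s 0)).
  by move=> hs; apply: is_deriveB; apply: d1.
have [s s0 Es] : exists2 s, s \in `]0, h[%R &
    phi h - phi 0 = ('D_e1 g (Q s h) - 'D_e1 g (Q s 0)) * (h - 0).
  apply: MVT => // [s|].
    by rewrite in_itv /= => /andP[a b]; apply: dphi; rewrite !ltW.
  apply: derivable_within_continuous => s; rewrite in_itv /= => hs.
  exact: (@ex_derive _ _ _ _ _ _ _ (dphi s hs)).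
have hs : 0 <= s <= h.
  by move: s0; rewrite in_itv /= => /andP[a b]; rewrite !ltW.
have Qs t : Q s t = t *: e2 + (s *: e1 + p) by rewrite /Q addrCA.
have dchi t : 0 <= t <= h ->
    is_derive t 1 (fun t : R => 'D_e1 g (Q s t)) ('D_e2 ('D_e1 g) (Q s t)).
  move=> ht; have [_] := dg s t hs ht.
  have -> : (fun t : R => 'D_e1 g (Q s t)) =
      (fun t : R => 'D_e1 g (t *: e2 + (s *: e1 + p))).
    by apply/funext => t'; rewrite Qs.
  by rewrite Qs => ?; apply: is_derive_line.
have [t t0 Et] : exists2 t, t \in `]0, h[%R &
    'D_e1 g (Q s h) - 'D_e1 g (Q s 0) = 'D_e2 ('D_e1 g) (Q s t) * (h - 0).
  apply: (@MVT _ (fun t => 'D_e1 g (Q s t)) (fun t => 'D_e2 ('D_e1 g) (Q s t))).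
  - exact: h0.
  - by move=> t; rewrite in_itv /= => /andP[a b]; apply: dchi; rewrite !ltW.
  - apply: derivable_within_continuous => t; rewrite in_itv /= => ht.
    exact: (@ex_derive _ _ _ _ _ _ _ (dchi t ht)).
exists s, t; split=> //.
  by move: t0; rewrite in_itv /= => /andP[a b]; rewrite !ltW.
move: Es; rewrite Et subr0 /phi !Q0 scale0r add0r => <-.
by rewrite /Q scale0r add0r; ring.
Qed.

Lemma mixed_partials_real (U : set (R * R)) (g : R * R -> R) p : open U ->
  smooth_on U g -> U p ->
  partial false (partial true g) p = partial true (partial false g) p.
Proof.
move=> hU sg Up; apply/eqP; rewrite -subr_eq0 -normr_eq0 eq_le normr_ge0 andbT.
apply/ler_addgt0Pr => /= e e0; rewrite add0r.
have near_p (F : R * R -> R) : smooth_on U F ->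
    \forall q \near p, `|F p - F q| < e / 2.
  move=> sF; have /cvgrPdist_lt := smooth_cont sF Up.
  by apply; rewrite divr_gt0.
have n1 := near_p _ (smooth_partial false (smooth_partial true sg)).
have n2 := near_p _ (smooth_partial true (smooth_partial false sg)).
have nU : nbhs p U by exact: open_nbhs_nbhs.
have nbr : nbhs p (U `&` ([set q | `|partial false (partial true g) p -
    partial false (partial true g) q| < e / 2] `&`
    [set q | `|partial true (partial false g) p -
    partial true (partial false g) q| < e / 2])).
  exact: (filterI nU (filterI n1 n2)).
have [r /= r0 br] := (nbhs_ballP _ _).1 nbr.
pose h := r / 2; have h0 : 0 < h by rewrite divr_gt0.
have hr : h < r by rewrite /h; lra.
have inb s t : 0 <= s <= h -> 0 <= t <= h -> ball p r ((s, t) + p).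
  move=> /andP[s0 sh] /andP[t0 th]; case: (p) => p1 p2.
  split; rewrite /ball /= opprD addrCA subrr addr0 normrN ger0_norm //.
    exact: le_lt_trans hr.
  exact: le_lt_trans hr.
have E1 (s t : R) : s *: dir R true + (t *: dir R false + p) = (s, t) + p.
  rewrite addrA; congr (_ + _).
  transitivity ((s * 1 + t * 0, s * 0 + t * 1) : R * R); first by [].
  by rewrite !mulr0 !mulr1 add0r addr0.
have E2 (s t : R) : s *: dir R false + (t *: dir R true + p) = (t, s) + p.
  by rewrite addrCA E1.
have dg i j q : ball p r q ->
    derivable g q (dir R i) /\ derivable ('D_(dir R i) g) q (dir R j).
  move=> /br [Uq _]; have [d1 _] := is_partial i sg Uq.
  by have [d2 _] := is_partial j (smooth_partial i sg) Uq; 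
    rewrite -partial_derive.
have [s t hs ht|s1 [t1 [hs1 ht1 D1]]] :=
    @second_difference _ g p (dir R true) (dir R false) h h0.
  by apply: dg; rewrite E1; exact: inb.
have [s t hs ht|s2 [t2 [hs2 ht2 D2]]] :=
    @second_difference _ g p (dir R false) (dir R true) h h0.
  by apply: dg; rewrite E2; exact: inb.
have {D2} D2 : partial false (partial true g) ((s1, t1) + p) =
    partial true (partial false g) ((t2, s2) + p).
  apply: (mulIf (lt0r_neq0 h0)); apply: (mulIf (lt0r_neq0 h0)).
  rewrite !partial_derive -(E1 s1 t1) -(E2 s2 t2) -D1 -D2.
  by rewrite [h *: dir R true + (_ + _)]addrCA; congr (_ + _); rewrite addrAC.
have := (br _ (inb t2 s2 ht2 hs2)).2.2.
have := (br _ (inb s1 t1 hs1 ht1)).2.1.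
rewrite /mkset D2.
move: (partial true _ p) (partial false _ p) (partial true _ _) => A B C.
rewrite !ltr_norml ler_norml => /andP[a1 a2] /andP[a3 a4].
by apply/andP; split; lra.
Qed.

End MixedPartials.

Section LinearMaps.
Variables (R : realType) (m : nat).
Implicit Types W : normedModType R.

Lemma linear_rV_continuous W (l : 'rV[R]_m -> W) : linear l -> continuous l.
Proof.
move=> hl; pose lL := GRing.isLinear.Build R 'rV[R]_m W *:%R l hl.
pose l' : {linear 'rV[R]_m -> W} := HB.pack l lL.
have -> : l = \sum_(j < m) (fun x : 'rV[R]_m => x 0 j *: l (delta_mx 0 j)).
  apply/funext => x; rewrite fct_sumE.
  transitivity (l' (\sum_(j < m) x 0 j *: delta_mx 0 j)).
    by rewrite -row_sum_delta.
  rewrite linear_sum.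
  by apply: eq_bigr => j _; rewrite linearZ.
move=> x; apply: (big_ind (fun f : 'rV[R]_m -> W => continuous_at x f)).
- exact: (@cst_continuous _ _ (0 : W) x).
- by move=> f g cf cg; exact: continuousD.
move=> j _.
exact: (cvgZ (@coord_continuous _ _ _ 0 j x) (cvg_cst _)).
Qed.

Section Pairing.
Variable B : {symmetric 'rV[R]_m}.
Implicit Types x y z : 'rV[R]_m.

Lemma ipC x y : B x y = B y x.
Proof. by rewrite hermC expr0 mul1r. Qed.

Lemma ipDl x y z : B (x + y) z = B x z + B y z.
Proof. exact: linearDl. Qed.

Lemma ipDr x y z : B z (x + y) = B z x + B z y.
Proof. exact: linearDr. Qed.

Lemma ipNl x y : B (- x) y = - B x y.
Proof. exact: linearNl. Qed.

Lemma ipNr x y : B x (- y) = - B x y.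
Proof. exact: linearNr. Qed.

Lemma ipZl (k : R) x y : B (k *: x) y = k * B x y.
Proof. exact: linearZl_LR. Qed.

Lemma ipZr (k : R) x y : B x (k *: y) = k * B x y.
Proof. exact: linearZr_LR. Qed.

Lemma ip0l x : B 0 x = 0.
Proof. exact: linear0l. Qed.

Lemma cont_bilinear_form : cont_bilinear (fun x y => B x y : R^o).
Proof.
split=> [y k a b|x k a b|]; first by rewrite ipDl ipZl.
  by rewrite ipDr ipZr.
have -> : (fun z : 'rV[R]_m * 'rV[R]_m => B z.1 z.2 : R^o) =
    \sum_(j < m) (fun z : 'rV[R]_m * 'rV[R]_m =>
      z.1 0 j *: (B (delta_mx 0 j) z.2 : R^o)).
  apply/funext => z; rewrite fct_sumE {1}[z.1]row_sum_delta.
  elim/big_rec2 : _ => [|j a b _ <-]; first by rewrite ip0l.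
  by rewrite ipDl ipZl.
move=> z; apply: (big_ind
  (fun f : 'rV[R]_m * 'rV[R]_m -> R^o => continuous_at z f)).
- exact: (@cst_continuous _ _ (0 : R^o) z).
- by move=> f g cf cg; exact: continuousD.
move=> j _.
apply: cvgZ.
  exact: (@cvg_comp _ _ _ fst (fun x : 'rV[R]_m => x 0 j) _ _ _ cvg_fst
    (@coord_continuous _ _ _ _ _ z.1)).
apply: (@cvg_comp _ _ _ snd (fun x : 'rV[R]_m => B (delta_mx 0 j) x : R^o)
   _ _ _ cvg_snd).
apply: (@linear_rV_continuous _ (fun x => B (delta_mx 0 j) x : R^o)).
by move=> k a b; rewrite ipDr ipZr.
Qed.

End Pairing.
End LinearMaps.

Section LinearCalculus.
Variables (R : realType) (U : set (R * R)).
Hypothesis hU : open U.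
Implicit Types (W : normedModType R) (i : bool).

Lemma cont_bilinear_linear W1 W (l : W1 -> W) : linear l -> continuous l ->
  cont_bilinear (fun (k : R) (x : W1) => k *: l x).
Proof.
move=> hl cl; have [h1 h2 h3] := @cont_bilinear_scale R W.
split=> [y k a b|x k a b|]; first exact: h1.
  by rewrite hl; exact: h2.
move=> z; apply: cvgZ; first exact: cvg_fst.
by apply: cvg_comp cvg_snd _; exact: cl.
Qed.

Lemma smooth_linear W1 W (l : W1 -> W) (f : R * R -> W1) :
  linear l -> continuous l -> smooth_on U f -> smooth_on U (fun q => l (f q)).
Proof.
move=> hl cl sf.
apply: (@eq_smooth _ _ hU _ (fun q => (1 : R) *: l (f q))).
  by move=> q _; rewrite scale1r.
apply: (smooth_bilinear hU (cont_bilinear_linear hl cl)) => //.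
exact: smooth_cst.
Qed.

Lemma partial_linear W1 W (l : W1 -> W) i (f : R * R -> W1) p :
  linear l -> continuous l -> smooth_on U f -> U p ->
  partial i (fun q => l (f q)) p = l (partial i f p).
Proof.
move=> hl cl sf Up.
rewrite (@eq_partial _ _ hU _ i _ (fun q => (1 : R) *: l (f q)) p Up); last first.
  by move=> q _; rewrite scale1r.
rewrite (partial_bilinear i (cont_bilinear_linear hl cl) _ sf Up).
  by rewrite partial_cst scale0r add0r scale1r.
exact: smooth_cst.
Qed.

Lemma mixed_partials m (f : R * R -> 'rV[R]_m) i j p : smooth_on U f -> U p ->
  partial i (partial j f) p = partial j (partial i f) p.
Proof.
wlog ij : i j / i = false /\ j = true.
  move=> H sf Up; case: i; case: j; [by []| | |by []].
    by apply/esym/H.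
  exact: H.
have [-> ->] := ij => sf Up; apply/rowP => k.
have lk : linear (fun x : 'rV[R]_m => x 0 k : R^o).
  by move=> a x y; rewrite !mxE.
have ck : continuous (fun x : 'rV[R]_m => x 0 k : R^o).
  exact: coord_continuous.
have pk i' (g : R * R -> 'rV[R]_m) q : smooth_on U g -> U q ->
    partial i' (fun q => g q 0 k : R^o) q = partial i' g q 0 k.
  by move=> sg Uq; exact: (partial_linear i' lk ck sg Uq).
have := mixed_partials_real hU (smooth_linear lk ck sf) Up.
rewrite (@eq_partial _ _ hU _ _ _ (fun q => partial true f q 0 k : R^o) p Up);
  last by move=> q; exact: pk.
rewrite [RHS](@eq_partial _ _ hU _ _ _ (fun q => partial false f q 0 k : R^o)
  p Up); last by move=> q; exact: pk.
by rewrite (pk false _ p (smooth_partial true sf) Up)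
  (pk true _ p (smooth_partial false sf) Up).
Qed.

Variables (m : nat) (B : {symmetric 'rV[R]_m}).

Lemma smooth_form (f g : R * R -> 'rV[R]_m) :
  smooth_on U f -> smooth_on U g -> smooth_on U (fun q => B (f q) (g q) : R^o).
Proof. exact: (smooth_bilinear hU (cont_bilinear_form B)). Qed.

Lemma partial_form i (f g : R * R -> 'rV[R]_m) p :
  smooth_on U f -> smooth_on U g -> U p ->
  partial i (fun q => B (f q) (g q) : R^o) p =
  B (partial i f p) (g p) + B (f p) (partial i g p).
Proof. exact: (partial_bilinear i (cont_bilinear_form B)). Qed.

Lemma form_skew i (f g : R * R -> 'rV[R]_m) (c : R) p :
  smooth_on U f -> smooth_on U g -> (forall q, U q -> B (f q) (g q) = c) ->
  U p -> B (partial i f p) (g p) = - B (f p) (partial i g p).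
Proof.
move=> sf sg fg Up; apply/eqP; rewrite -subr_eq0 opprK -partial_form//.
rewrite (@eq_partial _ _ hU _ _ _ (fun=> c : R^o) p Up); last exact: fg.
by rewrite partial_cst.
Qed.

End LinearCalculus.

Section Reflection.
Variable R : realType.
Implicit Types (W : normedModType R) (i : bool) (U : set (R * R)).

Lemma reflect_vK : involutive (@reflect_v R).
Proof. by case=> a b; rewrite /reflect_v /= opprK. Qed.

Lemma reflect_v_continuous : continuous (@reflect_v R).
Proof.
move=> p.
have c1 : q.1 @[q --> p] --> p.1 by exact: cvg_fst.
have c2 : - q.2 @[q --> p] --> - p.2 by apply: cvgN; exact: cvg_snd.
exact: (cvg_pair c1 c2).
Qed.

Lemma is_derive_opp W (f : R * R -> W) p v df :
  is_derive p v f df -> is_derive p (- v) f (- df).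
Proof.
move=> [fp <-].
suff H : (fun h => h^-1 *: ((f \o shift p) (h *: - v) - f p)) @ 0^' -->
    - 'D_v f p.
  by apply: DeriveDef; [apply/cvg_ex; eexists; exact: H | exact: cvg_lim H].
have -> : (fun h : R => h^-1 *: ((f \o shift p) (h *: - v) - f p)) =
  (fun h => - ((- h)^-1 *: ((f \o shift p) ((- h) *: v) - f p))).
  by apply/funext => h; rewrite invrN scaleNr opprK scalerN -scaleNr.
apply: cvgN.
have cN : (- h : R) @[h --> 0^'] --> 0^'.
  move=> A [e /= e0 eA]; exists e => // h /= he h0; apply: eA.
    by move: he; rewrite /= !sub0r normrN opprK.
  by rewrite oppr_eq0.
exact: cvg_comp cN fp.
Qed.

Definition refl_sign i : R := if i then 1 else -1.

Lemma is_derive_reflect W i (f : R * R -> W) p df :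
  is_derive (reflect_v p) (dir R i) f df ->
  is_derive p (dir R i) (f \o @reflect_v R) (refl_sign i *: df).
Proof.
move=> fp.
have {}fp :
    is_derive (reflect_v p) (refl_sign i *: dir R i) f (refl_sign i *: df).
  case: i fp => fp; first by rewrite !scale1r.
  by rewrite !scaleN1r; exact: is_derive_opp.
suff E : (fun h : R => h^-1 *:
    (((f \o @reflect_v R) \o shift p) (h *: dir R i) -
    (f \o @reflect_v R) p)) =
  (fun h => h^-1 *: ((f \o shift (reflect_v p)) (h *: (refl_sign i *: dir R i))
    - f (reflect_v p))).
  by have [d <-] := fp; apply: DeriveDef; rewrite /derivable /derive E.
apply/funext => h /=; congr (_ *: (f _ - _)).
case: p {fp} => a b; rewrite /reflect_v; case: i => /=.
  transitivity ((h * 1 + a, - (h * 0 + b)) : R * R); first by [].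
  transitivity ((h * (1 * 1) + a, h * (1 * 0) - b) : R * R); last by [].
  by congr pair; ring.
transitivity ((h * 0 + a, - (h * 1 + b)) : R * R); first by [].
transitivity ((h * (-1 * 0) + a, h * (-1 * 1) - b) : R * R); last by [].
by congr pair; ring.
Qed.

Lemma partial_reflect W i U (f : R * R -> W) p : smooth_on U f ->
  U (reflect_v p) ->
  partial i (f \o @reflect_v R) p = refl_sign i *: partial i f (reflect_v p).
Proof.
move=> sf Up; rewrite partial_derive; apply: (@derive_val _ _ _ _ _ _ _ _).
by apply: is_derive_reflect; exact: is_partial sf Up.
Qed.

Lemma open_reflect U : open U -> open (@reflect_v R @^-1` U).
Proof.
by move=> oU; apply: open_comp => // p _; exact: reflect_v_continuous.
Qed.

Lemma smooth_reflect W U (f : R * R -> W) : open U -> smooth_on U f ->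
  smooth_on (@reflect_v R @^-1` U) (f \o @reflect_v R).
Proof.
move=> oU sf k; elim: k f sf => [|k IH] f sf.
  split=> // p Up; apply: cvg_comp (@reflect_v_continuous p) _.
  exact: smooth_cont sf Up.
apply/classCS; split.
  move=> p Up; apply: cvg_comp (@reflect_v_continuous p) _.
  exact: smooth_cont sf Up.
move=> i; split=> [p Up|].
  have := is_derive_reflect (is_partial i sf Up) => H.
  exact: (@ex_derive _ _ _ _ _ _ _ H).
apply: (@eq_classC _ _ (open_reflect oU) _ _
   (fun q => refl_sign i *: (partial i f \o @reflect_v R) q)).
  by move=> q Uq; rewrite (partial_reflect i sf).
apply: (classC_bilinear (open_reflect oU) (@cont_bilinear_scale R W)).
  exact: smooth_cst (open_reflect oU) _ _ _.
by apply: IH; exact: smooth_partial.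
Qed.

End Reflection.

(** * Conformal frames *)

Section Frames.
Variables (R : realType) (m : nat) (B : {symmetric 'rV[R]_m}).
Implicit Types x y z w : 'rV[R]_m.

Lemma span4P (a b c d x : 'rV[R]_m) :
  reflect (exists k1 k2 k3 k4, x = k1 *: a + k2 *: b + k3 *: c + k4 *: d)
    (x \in <<[:: a; b; c; d]>>%VS).
Proof.
apply: (iffP idP) => [|[k1 [k2 [k3 [k4 ->]]]]]; last first.
  by rewrite !rpredD// rpredZ// memv_span// !inE eqxx ?orbT.
rewrite !span_cons span_nil addv0.
case/memv_addP => _ /vlineP [k1 ->] [w1 /memv_addP [_ /vlineP [k2 ->]]].
case=> w2 /memv_addP [_ /vlineP [k3 ->] [_ /vlineP [k4 ->] ->]] -> ->.
by exists k1, k2, k3, k4; rewrite !addrA.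
Qed.

Lemma mem_orthov4 (a b c d x : 'rV[R]_m) :
  reflect [/\ B x a = 0, B x b = 0, B x c = 0 & B x d = 0]
    (x \in orthov B <<[:: a; b; c; d]>>%VS).
Proof.
apply: (iffP mem_orthovP) => [H|[xa xb xc xd] _ /span4P [k1 [k2 [k3 [k4 ->]]]]].
  by split; apply: H; rewrite memv_span// !inE eqxx ?orbT.
suff : B x (k1 *: a + k2 *: b + k3 *: c + k4 *: d) = 0 by [].
by rewrite !ipDr !ipZr xa xb xc xd !mulr0 !addr0.
Qed.

(** The inner products of [Y], its two null tangent vectors and its mixed
    second derivative, for asymptotic coordinates with [<Y_u, Y_v> = e]. *)
Definition conf_gram (e : R) (y0 y1 y2 z : 'rV[R]_m) : Prop :=
  [/\ e != 0,
      [/\ B y0 y0 = 0, B y0 y1 = 0, B y0 y2 = 0 & B y0 z = - e],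
      [/\ B y1 y1 = 0, B y2 y2 = 0 & B y1 y2 = e] &
      B y1 z = 0 /\ B y2 z = 0].

Lemma conf_gram_sym e y0 y1 y2 z : conf_gram e y0 y1 y2 z ->
  [/\ B y1 y0 = 0, B y2 y0 = 0, B y2 y1 = e &
      [/\ B z y0 = - e, B z y1 = 0 & B z y2 = 0]].
Proof.
by move=> [_ [_ g01 g02 g0z] [_ _ g12] [g1z g2z]]; do !split; rewrite ipC.
Qed.

Section GramMatrix.
Variables (e : R) (y0 y1 y2 z : 'rV[R]_m).
Hypothesis G : conf_gram e y0 y1 y2 z.
Let T := <<[:: y0; y1; y2; z]>>%VS.

(** The component in [T] along its orthogonal complement, by inverting the Gram
    matrix. *)
Definition frame_proj x : 'rV[R]_m :=
  (- (B z z * (B x y0 / e) + B x z) / e) *: y0 + (B x y2 / e) *: y1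
  + (B x y1 / e) *: y2 + (- (B x y0 / e)) *: z.

Lemma frame_proj_orth x : B x y0 = 0 ->
  frame_proj x = (- B x z / e) *: y0 + (B x y2 / e) *: y1 + (B x y1 / e) *: y2.
Proof.
by rewrite /frame_proj => ->; rewrite mul0r mulr0 add0r oppr0 scale0r addr0.
Qed.

Lemma frame_projE x : B (frame_proj x) y0 = B x y0 /\
  B (frame_proj x) y1 = B x y1 /\ B (frame_proj x) y2 = B x y2 /\
  B (frame_proj x) z = B x z.
Proof.
have [e0 [g00 g01 g02 g0z] [g11 g22 g12] [g1z g2z]] := G.
have [g10 g20 g21 [gz0 gz1 gz2]] := conf_gram_sym G.
rewrite /frame_proj !ipDl !ipZl g00 g01 g02 g0z g11 g22 g12 g1z g2z g10 g20
  g21 gz0 gz1 gz2.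
by do !split; field.
Qed.

Lemma frame_sub_normal x : x - frame_proj x \in orthov B T.
Proof.
have [p0 [p1 [p2 pz]]] := frame_projE x.
by apply/mem_orthov4; rewrite !ipDl !ipNl p0 p1 p2 pz !subrr.
Qed.

Lemma frame_proj_mem x : frame_proj x \in T.
Proof. by apply/span4P; rewrite /frame_proj; do 4!eexists; reflexivity. Qed.

Lemma frame_proj_id x : x \in T -> frame_proj x = x.
Proof.
have [e0 [g00 g01 g02 g0z] [g11 g22 g12] [g1z g2z]] := G.
have [g10 g20 g21 [gz0 gz1 gz2]] := conf_gram_sym G.
case/span4P => k1 [k2 [k3 [k4 ->]]].
rewrite /frame_proj !ipDl !ipZl g00 g01 g02 g0z g11 g22 g12 g1z g2z g10 g20
  g21 gz0 gz1 gz2.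
congr (_ *: _ + _ *: _ + _ *: _ + _ *: _); by field.
Qed.

Lemma tangent_cap_normal : (orthov B T :&: T = 0)%VS.
Proof.
apply/eqP; rewrite -subv0; apply/subvP => x; rewrite memv_cap => /andP[xN xT].
rewrite memv0 -(frame_proj_id xT) /frame_proj.
by move: xN => /mem_orthov4 [-> -> -> ->];
  rewrite !mul0r mulr0 addr0 oppr0 mul0r !scale0r !addr0.
Qed.

Lemma daddv_pi_unique x w : w \in orthov B T -> x - w \in T ->
  daddv_pi (orthov B T) T x = w.
Proof.
move=> wN xwT; have capTN := tangent_cap_normal.
have capNT : (T :&: orthov B T = 0)%VS by rewrite capvC.
have -> : x = w + (x - w) by rewrite addrC subrK.
rewrite linearD /= daddv_pi_id//.
have H := daddv_pi_add capTN (subvP (addvSr (orthov B T) T) _ xwT).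
have E : daddv_pi T (orthov B T) (x - w) = x - w by exact: daddv_pi_id.
by move: H; rewrite E => /(canRL (addrK _)); rewrite subrr => ->; rewrite addr0.
Qed.

Lemma daddv_pi_frame x : daddv_pi (orthov B T) T x = x - frame_proj x.
Proof.
apply: daddv_pi_unique; first exact: frame_sub_normal.
by rewrite subKr frame_proj_mem.
Qed.

End GramMatrix.
End Frames.

Section SurfaceFrames.
Variables (R : realType) (m : nat) (B : {symmetric 'rV[R]_m}).
Variable U : set (R * R).
Hypothesis hU : open U.
Implicit Types (Y : R * R -> 'rV[R]_m) (i : bool) (p : R * R).

Definition mixed Y p : 'rV[R]_m := partial true (partial false Y) p.

Definition conf_frame e Y p : Prop :=
  conf_gram B e (Y p) (partial true Y p) (partial false Y p) (mixed Y p).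

(** The canonical lift has [e = 1/2]; in the (-) case the lift of a polar surface
    comes with [e = - 1/2] in the same coordinates. *)
Definition asymptotic_lift e Y : Prop :=
  [/\ e != 0, smooth_on U Y &
   forall p, U p -> [/\ B (Y p) (Y p) = 0,
     forall i, B (partial i Y p) (partial i Y p) = 0 &
     B (partial true Y p) (partial false Y p) = e]].

Lemma mixedE Y i p : smooth_on U Y -> U p ->
  partial i (partial (~~ i) Y) p = mixed Y p.
Proof.
move=> sY Up; case: i; first by [].
exact: (mixed_partials hU false true sY Up).
Qed.

Lemma partial_mixedE Y i p : smooth_on U Y -> U p ->
  partial i (mixed Y) p = partial (~~ i) (partial i (partial i Y)) p.
Proof.
move=> sY Up.
rewrite -(mixed_partials hU i (~~ i) (smooth_partial i sY) Up).
apply: (eq_partial hU _ Up) => q Uq; rewrite -(mixedE (~~ i) sY Uq).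
by rewrite negbK.
Qed.

Lemma smooth_mixed Y : smooth_on U Y -> smooth_on U (mixed Y).
Proof.
by move=> sY; exact: (smooth_partial true (smooth_partial false sY)).
Qed.

Lemma form_self_partial i Y (f : R * R -> 'rV[R]_m) (c : R) p :
  smooth_on U f -> (forall q, U q -> B (f q) (f q) = c) ->
  U p -> B (f p) (partial i f p) = 0.
Proof.
move=> sf fc Up; have := form_skew hU i sf sf fc Up.
by rewrite ipC => /eqP; rewrite -addr_eq0 -mulr2n mulrn_eq0 /= => /eqP.
Qed.

(** All entries of the Gram matrix but [<Y_uv, Y_uv>] follow from the
    normalisation by differentiating it. *)
Lemma asymptotic_frame e Y p : asymptotic_lift e Y -> U p -> conf_frame e Y p.
Proof.
move=> [e0 sY hY] Up; have sP i := smooth_partial i sY.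
have g0 q : U q -> B (Y q) (Y q) = 0 by move=> /hY [].
have gd i q : U q -> B (Y q) (partial i Y q) = 0.
  exact: (form_self_partial i Y sY g0).
have gii i q : U q -> B (partial i Y q) (partial i Y q) = 0.
  by move=> /hY [].
have [_ _ guv] := hY p Up.
have gz i : B (partial i Y p) (mixed Y p) = 0.
  rewrite -(mixedE (~~ i) sY Up) negbK.
  exact: (form_self_partial (~~ i) Y (sP i) (gii i)).
split=> //; split; rewrite ?g0 ?gd ?gii//.
apply: oppr_inj; rewrite opprK.
by rewrite -(form_skew hU true sY (sP false) (gd false) Up).
Qed.

Lemma conf_tangentE Y p : conf_tangent Y p =
  <<[:: Y p; partial true Y p; partial false Y p; mixed Y p]>>%VS.
Proof. by rewrite /conf_tangent partial_uE partial_vE. Qed.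

Lemma mem_conf_normal Y p x :
  reflect [/\ B x (Y p) = 0, forall i, B x (partial i Y p) = 0 &
              B x (mixed Y p) = 0]
    (x \in conf_normal B Y p).
Proof.
rewrite /conf_normal conf_tangentE.
apply: (iffP (mem_orthov4 _ _ _ _ _ _)) => [[x0 xu xv xz]|[x0 xi xz]].
  by split=> // -[].
by split; [|exact: (xi true)|exact: (xi false)|].
Qed.

Lemma mem_conf_tangent Y p x :
  reflect (exists k1 k2 k3 k4, x = k1 *: Y p + k2 *: partial true Y p +
             k3 *: partial false Y p + k4 *: mixed Y p)
    (x \in conf_tangent Y p).
Proof. by rewrite conf_tangentE; exact: span4P. Qed.

Definition tangent_proj e Y p x : 'rV[R]_m :=
  frame_proj B e (Y p) (partial true Y p) (partial false Y p) (mixed Y p) x.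

Lemma normal_proj_unique e Y p x w : conf_frame e Y p ->
  w \in conf_normal B Y p -> x - w \in conf_tangent Y p ->
  normal_proj B Y p x = w.
Proof.
rewrite /normal_proj /conf_normal conf_tangentE => G wN xwT.
exact: (daddv_pi_unique G wN xwT).
Qed.

Lemma normal_projE e Y p x : conf_frame e Y p ->
  normal_proj B Y p x = x - tangent_proj e Y p x.
Proof.
rewrite /normal_proj /conf_normal conf_tangentE => G.
exact: (daddv_pi_frame G).
Qed.

End SurfaceFrames.

(** * Gauge transformations and spectral transforms *)

(** Identities between linear combinations of vectors, checked entrywise. *)
Ltac vec := apply/rowP => ?; rewrite !mxE; ring.

Section Endomorphisms.
Variables (R : realType) (m : nat) (f : 'End('rV[R]_m)).

Lemma endD x y : f (x + y) = f x + f y. Proof. exact: linearD. Qed.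
Lemma endB x y : f (x - y) = f x - f y. Proof. exact: linearB. Qed.
Lemma endN x : f (- x) = - f x. Proof. exact: linearN. Qed.
Lemma endZ c x : f (c *: x) = c *: f x. Proof. exact: linearZ. Qed.

End Endomorphisms.

Section Rank1.
Variables (R : realType) (m : nat) (B : {symmetric 'rV[R]_m}).
Variables (y v : 'rV[R]_m).

Definition rank1_fun (x : 'rV[R]_m) : 'rV[R]_m := B x y *: v.

Fact rank1_fun_linear : linear rank1_fun.
Proof. by move=> k x x'; rewrite /rank1_fun ipDl ipZl; vec. Qed.

HB.instance Definition _ :=
  GRing.isLinear.Build R 'rV[R]_m 'rV[R]_m *:%R rank1_fun rank1_fun_linear.

Definition rank1 : 'End('rV[R]_m) := linfun rank1_fun.

Lemma rank1E x : rank1 x = B x y *: v.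
Proof. by rewrite lfunE. Qed.

End Rank1.

Section Gauge.
Variables (R : realType) (m : nat) (B : {symmetric 'rV[R]_m}).
Variable U : set (R * R).
Hypothesis hU : open U.
Variables (minus : bool) (ct : R).
Implicit Types (Y X : R * R -> 'rV[R]_m) (i : bool) (p : R * R).

(** In adapted coordinates the two Hopf differentials are [dsign i] times one
    and the same section. *)
Definition dsign i : R := if i then 1 else (-1) ^+ minus.

Let eps : R := (-1) ^+ minus.

Lemma dsign_sq i : dsign i * dsign i = 1.
Proof. by case: i; rewrite /dsign ?mulr1// -expr2 sqrr_sign. Qed.

Lemma eps_sq : eps * eps = 1.
Proof. by rewrite -expr2 sqrr_sign. Qed.

(** [L^-1 d L = d - ct (A_u du + eps A_v dv)] with the infinitesimal rotations
    [A_u x = <x, Y_v> Y - <x, Y> Y_v] and [A_v x = <x, Y_u> Y - <x, Y> Y_u]: a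
    trivialisation of one of the flat connections attached to an isothermic
    surface. *)
Definition gauge Y Yt (L : R * R -> 'End('rV[R]_m)) : Prop :=
  [/\ forall p, U p -> forall x x', B (L p x) (L p x') = B x x',
      forall p, U p -> limg (L p) = fullv,
      forall p, U p -> L p (Y p) = Yt p &
      forall phi, smooth_on U phi ->
        smooth_on U (fun q => L q (phi q)) /\
        forall i p, U p -> partial i (fun q => L q (phi q)) p =
          L p (partial i phi p) -
          (dsign i * ct) *: (B (phi p) (partial (~~ i) Y p) *: Yt p -
                             B (phi p) (Y p) *: partial (~~ i) Yt p)].

(** What the normalised lift of a polar surface of [Y] satisfies, [a] being the
    logarithmic derivative of the normalising factor. The product [<k, Y>] is
    what makes the Schwarzians of [L X] differ from those of [X]. *)
Definition polar_lift Y X (a s : bool -> R * R -> R)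
    (k : R * R -> 'rV[R]_m) : Prop :=
  [/\ asymptotic_lift B U (eps / 2) X,
      forall p, U p -> B (X p) (Y p) = 0 /\
        forall i, B (X p) (partial i Y p) = 0,
      forall i p, U p -> partial i X p = - a i p *: X p +
        dsign i *: (a (~~ i) p *: Y p - partial (~~ i) Y p),
      forall p, U p -> k p \in conf_normal B X p /\ B (k p) (Y p) = 2^-1 &
      forall i p, U p -> partial i (partial i X) p =
        - (s i p / 2) *: X p + dsign i *: k p].

Section GaugedLift.
Variables (Y Yt X : R * R -> 'rV[R]_m) (L : R * R -> 'End('rV[R]_m)).
Variables (a s : bool -> R * R -> R) (k : R * R -> 'rV[R]_m).
Hypotheses (hY : asymptotic_lift B U 2^-1 Y) (hL : gauge Y Yt L).
Hypothesis hX : polar_lift Y X a s k.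

Let Xt q := L q (X q).
(* [L] is corrected because it carries the frame of [X] to that of [Xt] only up
   to a multiple of [Yt] in the mixed second derivative. *)
Let Phi q : 'End('rV[R]_m) := L q + rank1 B (ct *: Y q) (Xt q).

Lemma gauge_partial i p : U p -> L p (partial i Y p) = partial i Yt p.
Proof.
move=> Up; have [_ _ LY hd] := hL; have [_ sY _] := hY.
have [[_ [g0 gu gv _] _ _] [_ dY]] := (asymptotic_frame hU hY Up, hd _ sY).
have gi : B (Y p) (partial (~~ i) Y p) = 0 by case: (i).
have := dY i p Up; rewrite g0 gi !scale0r subrr scaler0 subr0 => <-.
by apply: (eq_partial hU _ Up) => q; exact: LY.
Qed.

(** The rotation [A] annihilates [X], which is orthogonal to [Y], [Y_u] and
    [Y_v]. *)
Lemma gauged_partial i p : U p -> partial i Xt p = L p (partial i X p).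
Proof.
move=> Up; have [_ _ _ hd] := hL; have [[_ sX _] XY _ _ _] := hX.
have [_ ->//] := hd _ sX.
by have [-> ->] := XY p Up; rewrite !scale0r subrr scaler0 subr0.
Qed.

Lemma gauged_polar i p : U p -> partial i Xt p = - a i p *: Xt p +
  dsign i *: (a (~~ i) p *: Yt p - partial (~~ i) Yt p).
Proof.
move=> Up; have [_ _ LY _] := hL; have [_ _ dX _ _] := hX.
rewrite gauged_partial// dX// -(LY p Up) -(gauge_partial _ Up).
by rewrite endD !endZ endB endZ.
Qed.

Lemma smooth_gauged : smooth_on U Xt.
Proof.
by have [_ _ _ hd] := hL; have [[_ sX _] _ _ _ _] := hX; have [] := hd _ sX.
Qed.

Lemma gauged_asymptotic : asymptotic_lift B U (eps / 2) Xt.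
Proof.
have [iso _ _ _] := hL; have [[e0 sX gX] _ _ _ _] := hX.
split=> //; first exact: smooth_gauged.
move=> p Up; rewrite !gauged_partial//.
have [g0 gi g1] := gX p Up; rewrite !iso//.
by split=> // i; rewrite gauged_partial// iso.
Qed.

Lemma polar_lift_pairings i p : U p ->
  [/\ B (partial i X p) (Y p) = 0, B (partial i X p) (partial (~~ i) Y p) = 0 &
      B (partial i X p) (partial i Y p) = - dsign i / 2].
Proof.
move=> Up; have [_ XY dX _ _] := hX.
have [_ [g0 gu gv _] [guu gvv guv] _] := asymptotic_frame hU hY Up.
have [x0 xi] := XY p Up; rewrite dX//.
rewrite !(ipDl, ipZl, ipNl) x0 !xi g0.
by case: (i) => /=; rewrite ?[B (partial _ Y p) (Y p)]ipC ?gu ?gv ?guu ?gvv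
  ?[B (partial false Y p) (partial true Y p)]ipC ?guv; split; field.
Qed.

Lemma gauged_partial2 i p : U p ->
  partial i (partial i Xt) p = L p (partial i (partial i X) p).
Proof.
move=> Up; have [_ _ _ hd] := hL; have [[_ sX _] _ _ _ _] := hX.
rewrite (eq_partial hU (g := fun q => L q (partial i X q)) i Up); last first.
  by move=> q Uq; exact: gauged_partial.
have [_ ->//] := hd _ (smooth_partial i sX).
have [-> -> _] := polar_lift_pairings i Up.
by rewrite !scale0r subrr scaler0 subr0.
Qed.

Lemma gauged_mixed p : U p ->
  mixed Xt p = L p (mixed X p) + (eps * ct / 2) *: Yt p.
Proof.
move=> Up; have [_ _ _ hd] := hL; have [[_ sX _] _ _ _ _] := hX.
rewrite /mixed.
rewrite (eq_partial hU (g := fun q => L q (partial false X q)) true Up);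
  last first.
  by move=> q Uq; exact: gauged_partial.
have [_ ->//] := hd _ (smooth_partial false sX).
have [x0 _ x1] := polar_lift_pairings false Up.
rewrite /= x0 x1 /dsign -/eps scale0r subr0 scalerA -scaleNr.
by congr (_ + _ *: _); field.
Qed.

Lemma PhiE p x : Phi p x = L p x + (ct * B x (Y p)) *: Xt p.
Proof. by rewrite add_lfunE rank1E ipZr. Qed.

Lemma Phi_normal p x : U p -> x \in conf_normal B X p ->
  Phi p x \in conf_normal B Xt p.
Proof.
move=> Up /mem_conf_normal [x0 xi xz]; have [iso _ LY _] := hL.
have [_ [t0 tu tv tz] _ _] := asymptotic_frame hU gauged_asymptotic Up.
have ti i : B (Xt p) (partial i Xt p) = 0 by case: i.
apply/mem_conf_normal; rewrite PhiE; split=> [|i|]; rewrite ipDl ipZl.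
- by rewrite t0 mulr0 addr0 /Xt (iso p Up) x0.
- by rewrite ti mulr0 addr0 (gauged_partial i Up) (iso p Up) xi.
rewrite tz (gauged_mixed Up) ipDr ipZr (iso p Up) -(LY p Up) (iso p Up) xz.
by field.
Qed.

Lemma Phi_isometry p x x' : U p -> x \in conf_normal B X p ->
  x' \in conf_normal B X p -> B (Phi p x) (Phi p x') = B x x'.
Proof.
move=> Up /mem_conf_normal [x0 _ _] /mem_conf_normal [x0' _ _].
have [iso _ _ _] := hL; have [[_ _ gX] _ _ _ _] := hX.
have [g0 _ _] := gX p Up.
rewrite !PhiE !(ipDl, ipDr, ipZl, ipZr) !iso// x0 g0 [B (X p) x']ipC x0'.
by ring.
Qed.

(** A preimage under [L] becomes normal to [X] after subtraction of the multiple
    of [X] that [Phi] adds. *)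
Lemma Phi_onto p : U p -> (Phi p @: conf_normal B X p)%VS = conf_normal B Xt p.
Proof.
move=> Up; apply/eqP; rewrite eqEsubv; apply/andP; split; apply/subvP => w.
  by move=> /memv_imgP [x xN ->]; exact: Phi_normal.
move=> /[dup] wN /mem_conf_normal [w0 wi wz].
have [iso onto LY _] := hL; have [_ XY _ _ _] := hX.
have : w \in limg (L p) by rewrite onto// memvf.
case/memv_imgP => x _ Ew.
have xX : B x (X p) = 0 by rewrite -(iso p Up) -Ew.
have E : B x (mixed X p) = - (eps * ct / 2) * B x (Y p).
  rewrite -(iso p Up) -Ew -[L p (mixed X p)](addrK ((eps * ct / 2) *: Yt p)).
  rewrite -gauged_mixed// ipDr ipNr wz ipZr -(LY p Up) Ew iso//.
  by ring.
have xN : x - (ct * B x (Y p)) *: X p \in conf_normal B X p.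
  have [aX _ _ _ _] := hX.
  have [_ [g0 gu gv gz] _ _] := asymptotic_frame hU aX Up.
  have gi i : B (X p) (partial i X p) = 0 by case: i.
  apply/mem_conf_normal.
  split=> [|i|]; rewrite ipDl ipNl ipZl.
  - by rewrite g0 mulr0 subr0 xX.
  - by rewrite gi mulr0 subr0 -(iso p Up) -Ew -(gauged_partial i Up) wi.
  by rewrite gz E; field.
apply/memv_imgP; exists (x - (ct * B x (Y p)) *: X p) => //.
have [X0 _] := XY p Up.
rewrite PhiE ipDl ipNl ipZl X0 endB endZ -Ew -/(Xt p).
by move: (Xt p) => z; vec.
Qed.

(** [d (L phi)] and [L (d phi)] differ by [ct] times the image of [A phi],
    and for [phi] normal to [X] this is a multiple of [X_i + a_i X]; so the two
    derivatives agree modulo the tangent space of [Xt]. *)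
Lemma Phi_parallel : parallel_isometry B U X Xt Phi.
Proof.
have [iso _ LY hd] := hL; have [aX XY dX _ _] := hX.
have [_ sY _] := hY; have [_ sX _] := aX.
split=> [p Up|phi [sphi phiN]].
  by split; [exact: Phi_onto|move=> x x'; exact: Phi_isometry].
have sphiY : smooth_on U (fun q => ct * B (phi q) (Y q) : R^o).
  apply: (smoothM hU); first exact: smooth_cst.
  exact: smooth_form.
have [sLphi dLphi] := hd _ sphi.
have Ephi : (fun q => Phi q (phi q)) =
    (fun q => L q (phi q) + (ct * B (phi q) (Y q)) *: Xt q).
  by apply/funext => q; rewrite PhiE.
split.
  by rewrite Ephi; apply: smoothD => //; exact: smoothZ smooth_gauged.
rewrite /D_u /D_v partial_uE partial_vE; suff H i p : U p ->
    normal_proj B Xt p (partial i (fun q => Phi q (phi q)) p) =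
    Phi p (normal_proj B X p (partial i phi p)).
  by move=> p Up; split; [exact: (H true)|exact: (H false)].
move=> Up; have GX := asymptotic_frame hU aX Up.
have GXt := asymptotic_frame hU gauged_asymptotic Up.
pose d := partial i phi p; pose T := tangent_proj B (eps / 2) X p d.
have Ed : normal_proj B X p d = d - T := normal_projE d GX.
have wN : d - T \in conf_normal B X p by rewrite -Ed; exact: memv_pi.
have dX0 : B d (X p) = 0.
  rewrite (form_skew hU i sphi sX (c := 0) _ Up) => [|q Uq].
    have /mem_conf_normal [_ -> _] := phiN p Up.
    by rewrite oppr0.
  by have /mem_conf_normal [] := phiN q Uq.
transitivity (Phi p (d - T)); last by rewrite -Ed.
apply: (normal_proj_unique GXt); first exact: Phi_normal.
have phiY : B (phi p) (partial (~~ i) Y p) = a (~~ i) p * B (phi p) (Y p).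
  have /mem_conf_normal [f0 fi _] := phiN p Up.
  have := fi i; rewrite dX// !(ipDr, ipZr, ipNr) f0 mulr0 add0r => /eqP.
  rewrite mulf_eq0 subr_eq0 => /orP[/eqP s0|/eqP ->//].
  by have := dsign_sq i; rewrite s0 mul0r => /eqP; rewrite eq_sym oner_eq0.
pose c0 := - B d (mixed X p) / (eps / 2).
pose c1 := B d (partial false X p) / (eps / 2).
pose c2 := B d (partial true X p) / (eps / 2).
have LT : L p T = c0 *: Xt p + c1 *: partial true Xt p +
    c2 *: partial false Xt p.
  (* No [X_uv] component occurs, as [<phi_i, X> = - <phi, X_i> = 0]. *)
  rewrite (gauged_partial true Up) (gauged_partial false Up).
  by rewrite -!endZ -!endD; congr (L p _); exact: frame_proj_orth dX0.
have EX : L p d - (dsign i * ct) *: (B (phi p) (partial (~~ i) Y p) *: Yt p -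
      B (phi p) (Y p) *: partial (~~ i) Yt p) =
    L p d - (ct * B (phi p) (Y p)) *: (partial i Xt p + a i p *: Xt p).
  rewrite gauged_polar// phiY; congr (_ - _).
  move: (B (phi p) (Y p)) (Yt p) (partial _ Yt p) (Xt p) => b y y' x.
  by vec.
rewrite Ephi (partialD i sLphi (smoothZ hU sphiY smooth_gauged) Up).
rewrite (partialZ i sphiY smooth_gauged Up) (dLphi i p Up) -/d EX PhiE endB LT.
apply/mem_conf_tangent.
pose n := ct * B (d - T) (Y p).
pose dd := partial i (fun q => ct * B (phi q) (Y q) : R^o) p.
exists (dd + c0 - n - ct * B (phi p) (Y p) * a i p), c1, c2, 0.
rewrite -/n -/dd scale0r addr0.
move: (L p d) (Xt p) (partial true Xt p) (partial false Xt p) (partial i Xt p).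
by move=> A C D E F; vec.
Qed.

(** [L] commutes with the pure second derivatives, so that [Xt_ii] is
    [- s_i / 2 Xt + dsign i L k]; replacing [L k] by [Phi k = L k + ct / 2 Xt]
    shifts the Schwarzian by [dsign i * ct]. *)
Lemma gauged_invariants i p : U p ->
  [/\ Phi p (k p) \in conf_normal B Xt p &
   partial i (partial i Xt) p =
     - ((s i p + dsign i * ct) / 2) *: Xt p + dsign i *: Phi p (k p)].
Proof.
move=> Up; have [_ _ _ hk ddX] := hX; have [kN kY] := hk p Up.
split; first exact: Phi_normal.
rewrite gauged_partial2// ddX// endD !endZ PhiE kY.
rewrite -/(Xt p); move: (Xt p) (L p (k p)) => A C.
by vec.
Qed.

End GaugedLift.
End Gauge.

(** * Spectral transforms in canonical coordinates *)

Section SpectralLifts.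
Variables (R : realType) (m : nat) (B : {symmetric 'rV[R]_m}).
Implicit Types (U : set (R * R)) (X : R * R -> 'rV[R]_m) (i : bool) (p : R * R).
Implicit Types (y : R * R -> {vspace 'rV[R]_m}).

(** The lift does not vanish because [<X, X_uv> = - 1/2]. *)
Lemma asymptotic_canonical U y X : open U -> asymptotic_lift B U 2^-1 X ->
  (forall p, U p -> y p = <[X p]>%VS) -> canonical_lift B U y X.
Proof.
move=> hU aX yX; have [_ sX gX] := aX.
rewrite /canonical_lift partial_uE partial_vE.
split=> [|p Up]; last by have [_ gi ->] := gX p Up; rewrite !gi.
split=> // p Up; have [g0 _ _] := gX p Up; split=> //; last exact: yX.
have [_ [_ _ _ gz] _ _] := asymptotic_frame hU aX Up.
apply/eqP => X0; move/eqP: gz; rewrite X0 ip0l eq_sym oppr_eq0 invr_eq0.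
by rewrite pnatr_eq0.
Qed.

Lemma canonical_timelike U y X : open U -> canonical_lift B U y X ->
  timelike B U y.
Proof.
move=> hU [lX gX] p Up; exists U, X; split=> // q Uq.
have [guu gvv guv] := gX q Uq.
(* [d/du + d/dv] and [d/du - d/dv] have square norms 1 and -1. *)
have gvu : B (partial_v X q) (partial_u X q) = 2^-1 by rewrite ipC.
exists (1, 1), (1, -1); rewrite /induced_metric /differential /=.
move: (partial_u X q) (partial_v X q) guu gvv guv gvu => xu xv guu gvv guv gvu.
rewrite !(ipDl, ipDr, ipZl, ipZr) guu gvv guv gvu.
by split; field.
Qed.

Lemma spectral_lifts_intro U minus ct y yt X Xt k s
    (Phi : R * R -> 'End('rV[R]_m)) : open U ->
  asymptotic_lift B U 2^-1 X -> asymptotic_lift B U 2^-1 Xt ->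
  (forall p, U p -> y p = <[X p]>%VS) -> (forall p, U p -> yt p = <[Xt p]>%VS) ->
  parallel_isometry B U X Xt Phi ->
  (forall p, U p -> k p \in conf_normal B X p /\
                    Phi p (k p) \in conf_normal B Xt p) ->
  (forall i p, U p -> partial i (partial i X) p =
     - (s i p / 2) *: X p + dsign R minus i *: k p) ->
  (forall i p, U p -> partial i (partial i Xt) p =
     - ((s i p + dsign R minus i * ct) / 2) *: Xt p +
     dsign R minus i *: Phi p (k p)) ->
  spectral_lifts B U minus ct y yt X Xt.
Proof.
move=> hU aX aXt yX ytX hPhi hk dX dXt.
have cX := asymptotic_canonical hU aX yX.
have cXt := asymptotic_canonical hU aXt ytX.
split=> //; [exact: canonical_timelike cX|exact: canonical_timelike cXt|].
pose kap i q := dsign R minus i *: k q.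
pose kapt i q := dsign R minus i *: Phi q (k q).
exists (kap true), (kap false), (s true), (s false), (kapt true), (kapt false).
exists (fun q => s true q + dsign R minus true * ct).
exists (fun q => s false q + dsign R minus false * ct).
split.
- move=> p Up; rewrite partial_uE partial_vE !dX//.
  by have [kN _] := hk p Up; split; rewrite ?memvZ.
- by move=> p Up; rewrite /kap scalerA -expr2 sqrr_sign.
- move=> p Up; rewrite partial_uE partial_vE !dXt//.
  by have [_ kN] := hk p Up; split; rewrite ?memvZ.
- by move=> p Up; rewrite mul1r.
exists Phi => // p Up phi phiN; have [kN _] := hk p Up.
by have [/(_ p Up)[_ iso] _] := hPhi; rewrite !ipZl iso.
Qed.

End SpectralLifts.

Section ReflectedSurface.
Variables (R : realType) (m : nat) (B : {symmetric 'rV[R]_m}).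
Variable U : set (R * R).
Hypothesis hU : open U.
Implicit Types (X : R * R -> 'rV[R]_m) (i : bool) (p : R * R).
Let r := @reflect_v R.
Let U' := r @^-1` U.

Lemma refl_sign_sq i : refl_sign R i * refl_sign R i = 1.
Proof. by case: i; rewrite /refl_sign ?mulr1// mulrNN mulr1. Qed.

Lemma partial2_reflect i j X p : smooth_on U X -> U' p ->
  partial i (partial j (X \o r)) p =
  (refl_sign R i * refl_sign R j) *: partial i (partial j X) (r p).
Proof.
move=> sX Up; have oU' := open_reflect hU.
rewrite (eq_partial oU' (g := fun q => refl_sign R j *: (partial j X \o r) q)
  i Up); last by move=> q Uq; exact: partial_reflect sX Uq.
have sjX := smooth_partial j sX.
rewrite (partialZ i (smooth_cst oU' _) (smooth_reflect hU sjX) Up).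
rewrite partial_cst scale0r add0r (partial_reflect i sjX Up) scalerA.
by rewrite mulrC.
Qed.

Lemma asymptotic_reflect e X : asymptotic_lift B U e X ->
  asymptotic_lift B U' (- e) (X \o r).
Proof.
move=> [e0 sX gX]; split; first by rewrite oppr_eq0.
  exact: smooth_reflect.
move=> p Up; have [g0 gi guv] := gX (r p) Up; split=> //.
  by move=> i; rewrite (partial_reflect i sX Up) ipZl ipZr gi !mulr0.
rewrite !(partial_reflect _ sX Up) ipZl ipZr guv /refl_sign.
by rewrite mul1r mulN1r.
Qed.

Lemma conf_normal_reflect X p : smooth_on U X -> U' p ->
  conf_normal B (X \o r) p = conf_normal B X (r p).
Proof.
move=> sX Up; apply/vspaceP => x.
have Z : mixed (X \o r) p = - mixed X (r p).
  by rewrite /mixed (partial2_reflect _ _ sX Up) mul1r scaleN1r.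
apply/mem_conf_normal/mem_conf_normal => -[x0 xi xz]; split=> //.
- move=> i; have := xi i; rewrite (partial_reflect i sX Up) ipZr => /eqP.
  rewrite mulf_eq0 => /orP[/eqP e0|/eqP //].
  by have := refl_sign_sq i; rewrite e0 mul0r => /eqP; rewrite eq_sym oner_eq0.
- by have /eqP := xz; rewrite Z ipNr oppr_eq0 => /eqP.
- by move=> i; rewrite (partial_reflect i sX Up) ipZr xi mulr0.
by rewrite Z ipNr xz oppr0.
Qed.

Lemma conf_tangent_reflect X p : smooth_on U X -> U' p ->
  conf_tangent (X \o r) p = conf_tangent X (r p).
Proof.
move=> sX Up; rewrite !conf_tangentE; apply/vspaceP => x.
have Z : mixed (X \o r) p = - mixed X (r p).
  by rewrite /mixed (partial2_reflect _ _ sX Up) mul1r scaleN1r.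
have E1 : partial true (X \o r) p = partial true X (r p).
  by rewrite (partial_reflect _ sX Up) scale1r.
have E2 : partial false (X \o r) p = - partial false X (r p).
  by rewrite (partial_reflect _ sX Up) scaleN1r.
rewrite E1 E2 Z; apply/span4P/span4P => -[k1 [k2 [k3 [k4 ->]]]];
  by exists k1, k2, (- k3), (- k4); rewrite ?scaleNr ?scalerN ?opprK.
Qed.

Lemma normal_proj_reflect X p : smooth_on U X -> U' p ->
  normal_proj B (X \o r) p = normal_proj B X (r p).
Proof.
move=> sX Up; rewrite /normal_proj (conf_normal_reflect sX Up).
by rewrite (conf_tangent_reflect sX Up).
Qed.

Lemma parallel_isometry_reflect X Xt (Phi : R * R -> 'End('rV[R]_m)) :
  smooth_on U X -> smooth_on U Xt ->
  parallel_isometry B U X Xt Phi ->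
  parallel_isometry B U' (X \o r) (Xt \o r) (Phi \o r).
Proof.
move=> sX sXt [iso par]; have oU' := open_reflect hU.
split=> [p Up|phi [sphi phiN]].
  rewrite (conf_normal_reflect sX Up) (conf_normal_reflect sXt Up).
  exact: iso.
have U'' : r @^-1` U' = U.
  by apply/seteqP; split=> p; rewrite /U' /preimage /= /r reflect_vK.
pose phi' := phi \o r.
have sphi' : smooth_on U phi'.
  by have := smooth_reflect oU' sphi; rewrite -/r U''.
have phiN' : normal_section B U X phi'.
  split=> // p Up.
  have U'p : U' (r p) by rewrite /U' /preimage /= /r reflect_vK.
  have := phiN _ U'p; rewrite (conf_normal_reflect sX U'p).
  by rewrite /phi' /= /r reflect_vK.
have [sphit dphit] := par _ phiN'.
have E : (fun q => (Phi \o r) q (phi q)) = (fun q => Phi q (phi' q)) \o r.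
  by apply/funext => q; rewrite /phi' /= /r reflect_vK.
have Ephi : phi = phi' \o r.
  by apply/funext => q; rewrite /phi' /= /r reflect_vK.
rewrite E; split; first exact: smooth_reflect.
move=> p Up; have [du dv] := dphit (r p) Up.
move: du dv; rewrite /D_u /D_v partial_uE partial_vE => du dv.
rewrite (normal_proj_reflect sX Up) (normal_proj_reflect sXt Up).
rewrite !(partial_reflect _ sphit Up) {1 2}Ephi.
rewrite !(partial_reflect _ sphi' Up) /refl_sign !scale1r !scaleN1r.
split; first exact: du.
move: dv; rewrite [(Phi \o r) p]/=.
move: (normal_proj B Xt _) (normal_proj B X _) (Phi (r p)) => N1 N2 F.
by rewrite !endN => ->.
Qed.

End ReflectedSurface.

Section GaugeSpectral.
Variables (R : realType) (m : nat) (B : {symmetric 'rV[R]_m}).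
Variable U : set (R * R).
Hypothesis hU : open U.

(** For [minus = true] the lift satisfies [<X_u, X_v> = - 1/2], so that the
    coordinates in which it is canonical are [(u, - v)]. *)
Lemma gauge_spectral_transform minus ct Y Yt X L a s k
    (y yt : R * R -> {vspace 'rV[R]_m}) :
  asymptotic_lift B U 2^-1 Y -> gauge B U minus ct Y Yt L ->
  polar_lift B U minus Y X a s k ->
  (forall p, U p -> y p = <[X p]>%VS) ->
  (forall p, U p -> yt p = <[L p (X p)]>%VS) ->
  spectral_transform B U minus ct y yt.
Proof.
move=> hY hL hX yX ytX.
have par := Phi_parallel hU hY hL hX.
have inv := gauged_invariants hU hY hL hX.
have aXt := gauged_asymptotic hL hX.
have [aX _ _ hk ddX] := hX; have [_ sX _] := aX; have [_ sXt _] := aXt.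
pose Xt q := L q (X q).
case: minus => [] in hL hX par inv aX aXt hk ddX *; last first.
  left; exists X, Xt; move: aX aXt; rewrite expr0 mul1r => aX aXt.
  apply: (spectral_lifts_intro (k := k) (s := s) hU aX aXt yX ytX par).
  - by move=> p Up; split; [exact: (hk p Up).1|exact: (inv true p Up).1].
  - exact: ddX.
  by move=> i p Up; exact: (inv i p Up).2.
right; exists (X \o @reflect_v R), (Xt \o @reflect_v R).
have e2 : - ((-1) ^+ true / 2) = 2^-1 :> R by rewrite expr1 mulN1r opprK.
have := asymptotic_reflect hU aX; rewrite e2 => aX'.
have := asymptotic_reflect hU aXt; rewrite e2 => aXt'.
apply: (spectral_lifts_intro (k := k \o @reflect_v R)
  (s := fun i => s i \o @reflect_v R) (open_reflect hU) aX' aXt' _ _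
  (parallel_isometry_reflect hU sX sXt par)).
- by move=> p Up; exact: yX.
- by move=> p Up; exact: ytX.
- move=> p Up; rewrite (conf_normal_reflect B hU sX Up).
  rewrite (conf_normal_reflect B (X := Xt) hU sXt Up).
  by split; [exact: (hk _ Up).1|exact: (inv true _ Up).1].
- move=> i p Up; rewrite (partial2_reflect hU i i sX Up) refl_sign_sq scale1r.
  exact: ddX.
move=> i p Up.
rewrite (partial2_reflect (X := Xt) hU i i sXt Up) refl_sign_sq scale1r.
exact: (inv i _ Up).2.
Qed.

End GaugeSpectral.

(** * The canonical lift of a polar surface *)

Section PolarLift.
Variables (R : realType) (m : nat) (B : {symmetric 'rV[R]_m}).
Variable U : set (R * R).
Hypothesis hU : open U.
Variables (minus : bool) (Y psi : R * R -> 'rV[R]_m) (f : R * R -> R).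
Implicit Types (i : bool) (p : R * R).
Local Notation sg := (dsign R minus).
Local Notation eps := ((-1) ^+ minus : R).

(** The derivatives are those of a null section that is parallel in the
    conformal normal bundle of [Y] and has inner product [f] with the first Hopf
    differential. *)
Definition null_polar : Prop :=
  [/\ smooth_on U psi, smooth_on U (f : R * R -> R^o),
      forall p, U p -> f p != 0,
      forall p, U p -> B (psi p) (psi p) = 0 /\ psi p \in conf_normal B Y p &
      forall i p, U p -> partial i psi p =
        (2 * sg i) *: (partial (~~ i) (f : R * R -> R^o) p *: Y p -
                       f p *: partial (~~ i) Y p)].

Hypotheses (hY : asymptotic_lift B U 2^-1 Y) (hpsi : null_polar).

(** The factor turns [<psi_u, psi_v> = 2 eps f^2] into [eps / 2]. *)
Definition polar_canonical p : 'rV[R]_m := (2 * f p)^-1 *: psi p.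
Let X := polar_canonical.
Let fi i p : R := partial i (f : R * R -> R^o) p.
Definition log_derivative i p : R := fi i p / f p.
Let a := log_derivative.

Let sY : smooth_on U Y. Proof. by have [] := hY. Qed.
Let sf : smooth_on U (f : R * R -> R^o). Proof. by have [] := hpsi. Qed.
Let f0 p : U p -> f p != 0. Proof. by have [_ _ + _ _] := hpsi; exact. Qed.

Let s2f : smooth_on U (fun q => 2 * f q : R^o).
Proof. by apply: smoothM => //; exact: smooth_cst. Qed.

Let f20 p : U p -> 2 * f p != 0.
Proof. by move=> Up; rewrite mulf_neq0 ?f0// pnatr_eq0. Qed.

Let sg2 : smooth_on U (fun q => (2 * f q)^-1 : R^o).
Proof. exact: smoothV. Qed.

Let sX : smooth_on U X.
Proof. by apply: smoothZ => //; have [] := hpsi. Qed.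

Let sfV : smooth_on U (fun q => (f q)^-1 : R^o).
Proof. exact: smoothV. Qed.

Let sa i : smooth_on U (a i : R * R -> R^o).
Proof. exact: (smoothM hU (smooth_partial i sf) sfV). Qed.

Lemma polar_partial i p : U p ->
  partial i X p = - a i p *: X p +
    sg i *: (a (~~ i) p *: Y p - partial (~~ i) Y p).
Proof.
move=> Up; have [spsi _ _ _ dpsi] := hpsi.
rewrite (partialZ i sg2 spsi Up) (partialV i f20 s2f Up).
rewrite (partialM i (smooth_cst hU (2 : R^o)) sf Up) partial_cst mul0r add0r.
rewrite (dpsi i p Up) /X /polar_canonical /a /log_derivative.
rewrite -/(fi i p) -/(fi (~~ i) p).
have := f0 Up; move: (f p) (fi i p) (fi (~~ i) p) (Y p) (partial _ Y p) (psi p).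
move: (sg i) => s h h1 h2 v w x h0.
by apply/rowP => j; rewrite !mxE; field.
Qed.

Lemma log_derivative_mixed p : U p ->
  partial false (a true : R * R -> R^o) p =
  partial true (a false : R * R -> R^o) p.
Proof.
move=> Up; rewrite (partialM false (smooth_partial true sf) sfV Up).
rewrite (partialM true (smooth_partial false sf) sfV Up).
rewrite !(partialV _ f0 sf Up) (mixed_partials_real hU sf Up).
have H (x y z : R) : x * (- z * y) = y * (- z * x) by ring.
by congr (_ + _); exact: H.
Qed.

(** Modulo [X], both [X_uu] and [eps X_vv] are equal to this vector, which is why
    [X] is again isothermic. *)
Let n p : 'rV[R]_m :=
  (partial true (a false : R * R -> R^o) p - a true p * a false p) *: Y p +
  a true p *: partial false Y p + a false p *: partial true Y p - mixed Y p.

Lemma polar_partial2 i p : U p -> partial i (partial i X) p =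
  (a i p ^+ 2 - partial i (a i : R * R -> R^o) p) *: X p + sg i *: n p.
Proof.
move=> Up.
rewrite (eq_partial hU (g := fun q => (- a i q) *: X q +
    sg i *: (a (~~ i) q *: Y q + - partial (~~ i) Y q)) i Up); last first.
  by move=> q; exact: polar_partial.
have sna : smooth_on U (fun q => - a i q : R^o) by exact: smoothN.
have saY : smooth_on U (fun q => a (~~ i) q *: Y q) by exact: smoothZ.
have snY : smooth_on U (fun q => - partial (~~ i) Y q).
  by apply: smoothN => //; exact: smooth_partial.
have sw := smoothD hU saY snY.
have sc : smooth_on U (fun=> sg i : R^o) by exact: smooth_cst.
rewrite (partialD i (smoothZ hU sna sX) (smoothZ hU sc sw) Up).
rewrite (partialZ i sna sX Up) (partialN i (sa i) Up).
rewrite (partialZ i sc sw Up) partial_cst scale0r add0r.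
rewrite (partialD i saY snY Up) (partialZ i (sa (~~ i)) sY Up).
rewrite (partialN i (smooth_partial (~~ i) sY) Up) (mixedE hU i sY Up).
rewrite (polar_partial i Up) /n -(addrA _ (a true p *: _)).
have -> : partial i (a (~~ i) : R * R -> R^o) p =
    partial true (a false : R * R -> R^o) p.
  by case: (i) => //; exact: log_derivative_mixed.
have -> : a true p * a false p = a i p * a (~~ i) p.
  by case: (i) => //=; rewrite mulrC.
have -> : a true p *: partial false Y p + a false p *: partial true Y p =
    a i p *: partial (~~ i) Y p + a (~~ i) p *: partial i Y p.
  by case: (i) => //=; rewrite addrC.
move: (X p) (Y p) (partial i Y p) (partial (~~ i) Y p) (mixed Y p).
move: (partial i _ p) (partial true _ p) (a i p) (a (~~ i) p) (sg i).
by move=> c1 c2 c3 c4 c5 v1 v2 v3 v4 v5; vec.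
Qed.

Lemma polar_pairings p : U p ->
  [/\ B (X p) (X p) = 0, B (X p) (Y p) = 0,
      forall i, B (X p) (partial i Y p) = 0 & B (X p) (mixed Y p) = 0].
Proof.
move=> Up; have [_ _ _ hp _] := hpsi.
have [p0 /mem_conf_normal [y0 yi yz]] := hp p Up.
have E x : B (X p) x = (2 * f p)^-1 * B (psi p) x by rewrite ipZl.
by split=> [|||]; rewrite ?E ?ipZr ?p0 ?y0 ?yz ?mulr0// => i; rewrite E yi mulr0.
Qed.

Lemma polar_asymptotic : asymptotic_lift B U (eps / 2) X.
Proof.
split=> [|//|p Up]; first by rewrite mulf_neq0 ?signr_eq0// invr_neq0 ?pnatr_eq0.
have [x0 xY xi _] := polar_pairings Up.
have [_ [g00 g01 g02 _] [g11 g22 g12] _] := asymptotic_frame hU hY Up.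
have [g10 g20 g21 _] := conf_gram_sym (asymptotic_frame hU hY Up).
have yx : B (Y p) (X p) = 0 by rewrite ipC.
have ix i : B (partial i Y p) (X p) = 0 by rewrite ipC.
split=> [//|i|]; rewrite !(polar_partial _ Up);
  move: x0 xY yx xi ix; move: (X p) => x x0 xY yx xi ix.
  rewrite !(ipDl, ipDr, ipZl, ipZr, ipNl, ipNr) x0 xY yx !xi !ix g00.
  by case: (i) => /=; rewrite ?g01 ?g02 ?g10 ?g20 ?g11 ?g22; ring.
rewrite !(ipDl, ipDr, ipZl, ipZr, ipNl, ipNr) x0 xY yx !xi !ix g00 g01 g20 g21.
by rewrite /dsign /=; ring.
Qed.

(** The Hopf differential of [X] is [n] corrected by the multiple of [X] that
    makes it orthogonal to [X_uv]; [X] being null and orthogonal to its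
    tangents, the products of [n] with [X], [X_u] and [X_v] remain zero. *)
Lemma polar_lift_exists : exists s k, polar_lift B U minus Y X a s k.
Proof.
pose tau p := - 2 * eps * B (n p) (mixed X p).
exists (fun i p => - 2 * (a i p ^+ 2 - partial i (a i : R * R -> R^o) p +
                          sg i * tau p)).
exists (fun p => n p - tau p *: X p).
have aX := polar_asymptotic.
split=> [//|p Up|i p Up|p Up|i p Up].
- by have [_ xY xi _] := polar_pairings Up.
- exact: polar_partial.
- have [x0 xY xi xz] := polar_pairings Up.
  have GY := asymptotic_frame hU hY Up.
  have [_ [g00 g01 g02 g0z] [g11 g22 g12] [g1z g2z]] := GY.
  have [g10 g20 g21 [gz0 gz1 gz2]] := conf_gram_sym GY.
  have [_ [_ h01 h02 h0z] _ _] := asymptotic_frame hU aX Up.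
  have nX : B (n p) (X p) = 0.
    rewrite ipC /n; move: xY xi xz; move: (X p) => x xY xi xz.
    by rewrite !(ipDr, ipZr, ipNr) xY !xi xz; ring.
  have nY : B (n p) (Y p) = 2^-1.
    by rewrite /n !(ipDl, ipZl, ipNl) g00 g10 g20 gz0; ring.
  have nYi i : B (n p) (partial i Y p) = a i p / 2.
    rewrite /n !(ipDl, ipZl, ipNl); case: i.
      by rewrite g01 g11 g21 gz1; ring.
    by rewrite g02 g12 g22 gz2; ring.
  have Xi i : B (X p) (partial i X p) = 0 by case: i.
  split; last by rewrite ipDl ipNl ipZl nY xY mulr0 subr0.
  apply/mem_conf_normal; split=> [|i|]; rewrite ipDl ipNl ipZl.
  - by rewrite nX x0 mulr0 subr0.
  - rewrite Xi mulr0 subr0 (polar_partial i Up).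
    move: nX; move: (X p) => x nX; rewrite !(ipDr, ipZr, ipNr).
    by rewrite nX nY nYi; ring.
  rewrite h0z /tau; have := @eps_sq R minus.
  move: (eps) (B _ _) => e b e2.
  by transitivity (b - (e * e) * b); [field|rewrite e2 mul1r subrr].
rewrite (polar_partial2 i Up).
move: (X p) (n p) (tau p) (sg i) (partial _ _ p) (a i p) => x y t s c d.
by apply/rowP => j; rewrite !mxE; field.
Qed.

End PolarLift.

(** * The gauge transformation of a spectral transform *)

Section StructureEquations.
Variables (R : realType) (m : nat) (B : {symmetric 'rV[R]_m}).
Variable U : set (R * R).
Hypothesis hU : open U.
Implicit Types (i : bool) (p : R * R).

Definition hopf_schwarz (Z : R * R -> 'rV[R]_m)
    (kap : bool -> R * R -> 'rV[R]_m) (s : bool -> R * R -> R) : Prop :=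
  forall i p, U p -> kap i p \in conf_normal B Z p /\
    partial i (partial i Z) p = - (s i p / 2) *: Z p + kap i p.

Variables (Z : R * R -> 'rV[R]_m) (kap : bool -> R * R -> 'rV[R]_m).
Variable s : bool -> R * R -> R.
Hypotheses (aZ : asymptotic_lift B U 2^-1 Z) (hk : hopf_schwarz Z kap s).

Let sZ : smooth_on U Z. Proof. by have [] := aZ. Qed.

(** The Schwarzian is four times [<Z_ii, Z_uv>]. *)
Lemma smooth_schwarzian i : smooth_on U (s i : R * R -> R^o).
Proof.
apply: (@eq_smooth _ _ hU _
    (fun q => (4 : R^o) * B (partial i (partial i Z) q) (mixed Z q))).
  move=> q Uq; have [kN ->] := hk i Uq.
  have /mem_conf_normal [_ _ kz] := kN.
  have [_ [_ _ _ gz] _ _] := asymptotic_frame hU aZ Uq.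
  by rewrite ipDl ipZl kz gz; field.
apply: (smoothM hU); first exact: smooth_cst.
by apply: smooth_form => //; [do 2!apply: smooth_partial|exact: smooth_mixed].
Qed.

Lemma smooth_hopf i : smooth_on U (kap i).
Proof.
apply: (@eq_smooth _ _ hU _
    (fun q => partial i (partial i Z) q + (2^-1 * s i q) *: Z q)).
  by move=> q Uq; have [_ ->] := hk i Uq; vec.
apply: smoothD => //; first by do 2!apply: smooth_partial.
apply: smoothZ => //; apply: smoothM => //; last exact: smooth_schwarzian.
exact: smooth_cst.
Qed.

(** The remaining entry of the Gram matrix, by differentiating the vanishing
    products [<Z_u, Z_uv>] and [<Z_u, Z_vv>]. *)
Lemma form_mixed2 p : U p ->
  B (mixed Z p) (mixed Z p) = B (kap true p) (kap false p).
Proof.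
move=> Up; have sP i := smooth_partial i sZ.
have G q (Uq : U q) := asymptotic_frame hU aZ Uq.
have e1 q : U q -> B (partial true Z q) (mixed Z q) = 0 by case/G => _ _ _ [].
have e2 q : U q -> B (partial true Z q) (partial false (partial false Z) q) = 0.
  move=> Uq; have [kN ->] := hk false Uq.
  have /mem_conf_normal [_ kt _] := kN.
  have [_ [_ g01 _ _] _ _] := G q Uq.
  by rewrite ipDr ipZr [B _ (kap _ _)]ipC kt [B _ (Z q)]ipC g01 mulr0 addr0.
have := form_skew hU false (sP true) (smooth_mixed sZ) e1 Up.
have := form_skew hU true (sP true) (smooth_partial false (sP false)) e2 Up.
rewrite (mixedE hU false sZ Up) (mixed_partials hU true false (sP false) Up).
rewrite -/(mixed Z) => <- ->.
have [kNt ->] := hk true Up; have [kNf ->] := hk false Up.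
have /mem_conf_normal [kt0 _ _] := kNt; have /mem_conf_normal [kf0 _ _] := kNf.
have [_ [g00 _ _ _] _ _] := G p Up.
rewrite !(ipDl, ipDr, ipZl, ipZr) g00 kt0 [B (Z p) (kap _ _)]ipC kf0.
by ring.
Qed.

(** The tangential part of [d eta] is governed by the Hopf differentials: its
    component dual to [Z_uv] involves [<eta, Z_iij>] (with [j] the other
    direction), which is obtained by differentiating [<eta, kappa_i>]. *)
Lemma normal_section_derivative i (eta : R * R -> 'rV[R]_m) p :
  normal_section B U Z eta -> U p ->
  [/\ B (partial i eta p) (Z p) = 0,
      B (partial i eta p) (partial (~~ i) Z p) = 0,
      B (partial i eta p) (partial i Z p) = - B (eta p) (kap i p) &
      B (partial i eta p) (mixed Z p) =
        B (normal_proj B Z p (partial (~~ i) eta p)) (kap i p) -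
        partial (~~ i) (fun q => B (eta q) (kap i q) : R^o) p].
Proof.
move=> [seta Neta] Up; have sP j := smooth_partial j sZ.
have n0 q : U q -> B (eta q) (Z q) = 0.
  by move=> /Neta /mem_conf_normal [].
have nj j q : U q -> B (eta q) (partial j Z q) = 0.
  by move=> /Neta /mem_conf_normal [_ + _]; exact.
have nz q : U q -> B (eta q) (mixed Z q) = 0.
  by move=> /Neta /mem_conf_normal [].
have nii q : U q -> B (eta q) (partial i (partial i Z) q) = B (eta q) (kap i q).
  move=> Uq; have [_ ->] := hk i Uq.
  by rewrite ipDr ipZr n0// mulr0 add0r.
have d0 j : B (partial j eta p) (Z p) = 0.
  by rewrite (form_skew hU j seta sZ n0 Up) nj// oppr0.
split.
- exact: d0.
- rewrite (form_skew hU i seta (sP _) (nj _) Up) (mixedE hU i sZ Up).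
  by rewrite nz// oppr0.
- by rewrite (form_skew hU i seta (sP _) (nj _) Up) nii.
rewrite (form_skew hU i seta (smooth_mixed sZ) nz Up).
rewrite (partial_mixedE hU i sZ Up).
rewrite -(eq_partial hU
  (f := fun q => B (eta q) (partial i (partial i Z) q) : R^o) (~~ i) Up);
  last by move=> q; exact: nii.
rewrite (partial_form B (~~ i) seta (smooth_partial i (sP i)) Up).
have [kN ->] := hk i Up; have /mem_conf_normal [k0 kj kz] := kN.
have G := asymptotic_frame hU aZ Up.
have -> : B (normal_proj B Z p (partial (~~ i) eta p)) (kap i p) =
    B (partial (~~ i) eta p) (kap i p).
  rewrite (normal_projE _ G) ipDl ipNl /tangent_proj /frame_proj.
  rewrite !(ipDl, ipZl) ![B _ (kap i p)]ipC k0 !kj kz !mulr0 !addr0 subr0.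
  by rewrite ipC.
by rewrite ipDr ipZr d0 mulr0 add0r opprD addNKr.
Qed.

Lemma partial_mixed i p : U p -> partial i (mixed Z) p =
  - (partial (~~ i) (s i : R * R -> R^o) p / 2) *: Z p -
  (s i p / 2) *: partial (~~ i) Z p + partial (~~ i) (kap i) p.
Proof.
move=> Up; rewrite (partial_mixedE hU i sZ Up).
have ss : smooth_on U (fun q => (- 2^-1) * s i q : R^o).
  by apply: smoothM => //; [exact: smooth_cst|exact: smooth_schwarzian].
rewrite (eq_partial hU (g := fun q => ((- 2^-1) * s i q) *: Z q + kap i q) _ Up);
  last by move=> q Uq; have [_ ->] := hk i Uq; congr (_ *: _ + _); ring.
rewrite (partialD _ (smoothZ hU ss sZ) (smooth_hopf i) Up).
rewrite (partialZ _ ss sZ Up).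
rewrite (partialM _ (smooth_cst hU (- 2^-1 : R^o)) (smooth_schwarzian i) Up).
rewrite partial_cst mul0r add0r; congr (_ + _).
move: (Z p) (partial _ Z p) (partial _ _ p) (s i p) => z z' d c.
by vec.
Qed.

End StructureEquations.

Section GaugeConstruction.
Variables (R : realType) (m : nat) (B : {symmetric 'rV[R]_m}).
Hypothesis nondeg : forall x, (forall y, B x y = 0) -> x = 0.
Variable U : set (R * R).
Hypothesis hU : open U.
Variables (minus : bool) (ct : R) (Y Yt : R * R -> 'rV[R]_m).
Implicit Types (i : bool) (p : R * R).
Local Notation sg := (dsign R minus).
Variables (kap kapt : bool -> R * R -> 'rV[R]_m) (s st : bool -> R * R -> R).
Variable Phi : R * R -> 'End('rV[R]_m).
Hypothesis aY : asymptotic_lift B U 2^-1 Y.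
Hypothesis aYt : asymptotic_lift B U 2^-1 Yt.
Hypotheses (hk : hopf_schwarz B U Y kap s) (hkt : hopf_schwarz B U Yt kapt st).
Hypothesis hs : forall i p, U p -> st i p = s i p + sg i * ct.
Hypothesis hPhi : parallel_isometry B U Y Yt Phi.
Hypothesis hPhik : forall i p x, U p -> x \in conf_normal B Y p ->
  B (kapt i p) (Phi p x) = B (kap i p) x.

Let sY : smooth_on U Y. Proof. by have [] := aY. Qed.
Let sYt : smooth_on U Yt. Proof. by have [] := aYt. Qed.
Let G p (Up : U p) := asymptotic_frame hU aY Up.
Let Gt p (Up : U p) := asymptotic_frame hU aYt Up.

Let Phi_conf_normal p x : U p -> x \in conf_normal B Y p ->
  Phi p x \in conf_normal B Yt p.
Proof.
by move=> Up xN; have [/(_ p Up)[<- _] _] := hPhi; exact: memv_img.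
Qed.

Let Phi_iso p x x' : U p -> x \in conf_normal B Y p ->
  x' \in conf_normal B Y p -> B (Phi p x) (Phi p x') = B x x'.
Proof. by move=> Up xN xN'; have [/(_ p Up)[_ iso] _] := hPhi; exact: iso. Qed.

(** The inner product is non-degenerate on the normal space, because that
    space has the tangent space as an orthogonal complement. *)
Lemma hopf_corresponds i p : U p -> kapt i p = Phi p (kap i p).
Proof.
move=> Up; have [kN _] := hk i Up; have [ktN _] := hkt i Up.
apply/eqP; rewrite -subr_eq0; apply/eqP; apply: nondeg => z.
have xN : kapt i p - Phi p (kap i p) \in conf_normal B Yt p.
  exact: (memvB ktN (Phi_conf_normal Up kN)).
have H w : w \in conf_normal B Yt p -> B (kapt i p - Phi p (kap i p)) w = 0.
  have [/(_ p Up)[<- _] _] := hPhi; case/memv_imgP => x xNY ->.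
  by rewrite ipDl ipNl (hPhik i Up xNY) (Phi_iso Up kN xNY) subrr.
have /mem_conf_normal [x0 xi xz] := xN.
rewrite -[z](subrK (tangent_proj B 2^-1 Yt p z)) ipDr.
rewrite -(normal_projE z (Gt Up)) (H _ (memv_pi _ _ _)) add0r.
by rewrite /tangent_proj /frame_proj !(ipDr, ipZr) x0 !xi xz !mulr0 !addr0.
Qed.

Lemma form_mixed2_eq p : U p ->
  B (mixed Yt p) (mixed Yt p) = B (mixed Y p) (mixed Y p).
Proof.
move=> Up; rewrite (form_mixed2 hU aYt hkt Up) (form_mixed2 hU aY hk Up).
have [kt _] := hk true Up; have [kf _] := hk false Up.
rewrite (hopf_corresponds true Up) (hopf_corresponds false Up).
exact: Phi_iso.
Qed.

(** The coefficients of the tangential part of a vector in the frame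
    [Y, Y_u, Y_v, Y_uv], as in [frame_proj] with [e = 1/2]. *)
Let coef0 x p :=
  - (2 * B x (mixed Y p) + 4 * B (mixed Y p) (mixed Y p) * B x (Y p)).
Let coef i x p := 2 * B x (partial (~~ i) Y p).
Let coefz x p := - (2 * B x (Y p)).

(** The linear map extending [Phi] and carrying the frame [Y, Y_u, Y_v, Y_uv]
    to that of [Yt]. *)
Definition spectral_gauge p : 'End('rV[R]_m) :=
  (Phi p \o normal_proj B Y p)%VF
  + rank1 B (- (2 *: mixed Y p + (4 * B (mixed Y p) (mixed Y p)) *: Y p)) (Yt p)
  + rank1 B (2 *: partial false Y p) (partial true Yt p)
  + rank1 B (2 *: partial true Y p) (partial false Yt p)
  + rank1 B (- (2 *: Y p)) (mixed Yt p).
Let L := spectral_gauge.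

Let LE x p : L p x = Phi p (normal_proj B Y p x) + coef0 x p *: Yt p +
  coef true x p *: partial true Yt p + coef false x p *: partial false Yt p +
  coefz x p *: mixed Yt p.
Proof.
rewrite /L /spectral_gauge !add_lfunE comp_lfunE !rank1E.
by rewrite !(ipNr, ipDr, ipZr).
Qed.

Let frame_split x p : U p -> x = normal_proj B Y p x + coef0 x p *: Y p +
  coef true x p *: partial true Y p + coef false x p *: partial false Y p +
  coefz x p *: mixed Y p.
Proof.
move=> Up; rewrite (normal_projE x (G Up)) /tangent_proj /frame_proj.
rewrite /coef0 /coef /coefz /=.
move: (Y p) (partial true Y p) (partial false Y p) (mixed Y p) => y y1 y2 z.
by apply/rowP => j; rewrite !mxE; field.
Qed.

Let coefE eta c0 c1 c2 c3 p : U p -> eta \in conf_normal B Y p ->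
  let x := eta + c0 *: Y p + c1 *: partial true Y p + c2 *: partial false Y p +
    c3 *: mixed Y p in
  [/\ normal_proj B Y p x = eta, coef0 x p = c0, coef true x p = c1,
      coef false x p = c2 & coefz x p = c3].
Proof.
move=> Up eN x; have /mem_conf_normal [e0 ei ez] := eN.
have [_ [g00 g01 g02 g0z] [g11 g22 g12] [g1z g2z]] := G Up.
have [g10 g20 g21 [gz0 gz1 gz2]] := conf_gram_sym (G Up).
split.
- apply: (normal_proj_unique (G Up) eN); apply/mem_conf_tangent.
  exists c0, c1, c2, c3; rewrite /x.
  move: (Y p) (partial true Y p) (partial false Y p) (mixed Y p) => y y1 y2 z.
  by vec.
- rewrite /coef0 /x !(ipDl, ipZl) e0 ez g00 g10 g20 gz0 g0z g1z g2z.
  by field.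
- rewrite /coef /x /= !(ipDl, ipZl) ei g02 g12 g22 gz2; by field.
- rewrite /coef /x /= !(ipDl, ipZl) ei g01 g11 g21 gz1; by field.
by rewrite /coefz /x /= !(ipDl, ipZl) e0 g00 g10 g20 gz0; field.
Qed.

Let L_split eta c0 c1 c2 c3 p : U p -> eta \in conf_normal B Y p ->
  L p (eta + c0 *: Y p + c1 *: partial true Y p + c2 *: partial false Y p +
    c3 *: mixed Y p) =
  Phi p eta + c0 *: Yt p + c1 *: partial true Yt p + c2 *: partial false Yt p +
    c3 *: mixed Yt p.
Proof.
by move=> Up eN; have [E0 E1 E2 E3 E4] := coefE c0 c1 c2 c3 Up eN;
  rewrite LE E0 E1 E2 E3 E4.
Qed.

Lemma spectral_gauge_normal eta p : U p -> eta \in conf_normal B Y p ->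
  L p eta = Phi p eta.
Proof.
move=> Up eN; have := L_split 0 0 0 0 Up eN.
by rewrite !scale0r !addr0.
Qed.

Let L_Y p : U p -> L p (Y p) = Yt p.
Proof.
move=> Up; have := L_split 1 0 0 0 Up (mem0v _).
by rewrite linear0 !scale0r !addr0 !add0r !scale1r.
Qed.

Let L_dY i p : U p -> L p (partial i Y p) = partial i Yt p.
Proof.
move=> Up; case: i.
  have := L_split 0 1 0 0 Up (mem0v _).
  by rewrite linear0 !scale0r !addr0 !add0r !scale1r.
have := L_split 0 0 1 0 Up (mem0v _).
by rewrite linear0 !scale0r !addr0 !add0r !scale1r.
Qed.

Let L_mixed p : U p -> L p (mixed Y p) = mixed Yt p.
Proof.
move=> Up; have := L_split 0 0 0 1 Up (mem0v _).
by rewrite linear0 !scale0r !add0r !scale1r.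
Qed.

Let normal_projN x p : normal_proj B Y p x \in conf_normal B Y p.
Proof. exact: memv_pi. Qed.

Lemma spectral_gauge_isometry p x x' : U p -> B (L p x) (L p x') = B x x'.
Proof.
move=> Up; rewrite [in RHS](frame_split x Up) [in RHS](frame_split x' Up) !LE.
have hh := form_mixed2_eq Up.
move: (normal_projN x p) (normal_projN x' p).
move: (coef0 x p) (coef true x p) (coef false x p) (coefz x p) => c0 c1 c2 c3.
move: (coef0 x' p) (coef true x' p) (coef false x' p) (coefz x' p) => d0 d1 d2 d3.
move: (normal_proj B Y p x) (normal_proj B Y p x') => e e' eN eN'.
have gram E E' (Z : R * R -> 'rV[R]_m) : conf_frame B 2^-1 Z p ->
    E \in conf_normal B Z p -> E' \in conf_normal B Z p ->
    B (E + c0 *: Z p + c1 *: partial true Z p + c2 *: partial false Z p +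
         c3 *: mixed Z p)
      (E' + d0 *: Z p + d1 *: partial true Z p + d2 *: partial false Z p +
         d3 *: mixed Z p) =
    B E E' - (c0 * d3 + c3 * d0) / 2 + (c1 * d2 + c2 * d1) / 2 +
      c3 * d3 * B (mixed Z p) (mixed Z p).
  move=> GZ; have [_ [g00 g01 g02 g0z] [g11 g22 g12] [g1z g2z]] := GZ.
  move=> /mem_conf_normal [e0 ei ez] /mem_conf_normal [e0' ei' ez'].
  have [g10 g20 g21 [gz0 gz1 gz2]] := conf_gram_sym GZ.
  have f0 : B (Z p) E' = 0 by rewrite ipC.
  have f1 i : B (partial i Z p) E' = 0 by rewrite ipC.
  have fz : B (mixed Z p) E' = 0 by rewrite ipC.
  rewrite !(ipDl, ipDr, ipZl, ipZr) e0 !ei ez f0 !f1 fz.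
  rewrite g00 g01 g02 g0z g11 g22 g12 g1z g2z g10 g20 g21 gz0 gz1 gz2.
  by ring.
rewrite (gram _ _ _ (G Up) eN eN').
rewrite (gram _ _ _ (Gt Up) (Phi_conf_normal Up eN) (Phi_conf_normal Up eN')).
by rewrite (Phi_iso Up eN eN') hh.
Qed.

Lemma spectral_gauge_onto p : U p -> limg (L p) = fullv.
Proof.
move=> Up; apply/vspaceP => x; rewrite memvf; apply/idP.
rewrite -[x](subrK (tangent_proj B 2^-1 Yt p x)); apply: memvD.
  have : x - tangent_proj B 2^-1 Yt p x \in conf_normal B Yt p.
    by rewrite -(normal_projE x (Gt Up)); exact: memv_pi.
  have [/(_ p Up)[<- _] _] := hPhi; case/memv_imgP => w wN ->.
  by rewrite -(spectral_gauge_normal Up wN); exact: memv_img (memvf _).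
rewrite /tangent_proj /frame_proj -(L_Y Up) -!(L_dY _ Up) -(L_mixed Up).
by rewrite -!endZ -!endD; exact: memv_img (memvf _).
Qed.

(** The derivatives of a normal section and of its image have the same inner
    products with the two frames, hence the same tangential coefficients. *)
Lemma gauge_normal_section i (eta : R * R -> 'rV[R]_m) p :
  normal_section B U Y eta -> U p ->
  partial i (fun q => Phi q (eta q)) p = L p (partial i eta p).
Proof.
move=> eN Up; have [_ par] := hPhi; have [sPe dPe] := par _ eN.
have [_ Neta] := eN.
pose et q := Phi q (eta q).
have etN : normal_section B U Yt et.
  by split; [exact: sPe|move=> q Uq; exact: Phi_conf_normal (Neta q Uq)].
have D j : normal_proj B Yt p (partial j et p) =
    Phi p (normal_proj B Y p (partial j eta p)).
  have [] := dPe p Up; rewrite /D_u /D_v partial_uE partial_vE.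
  by case: j.
have [a0 a1 a2 a3] := normal_section_derivative hU aY hk i eN Up.
have [b0 b1 b2 b3] := normal_section_derivative hU aYt hkt i etN Up.
have [kN _] := hk i Up.
have bk q : U q -> B (et q) (kapt i q) = B (eta q) (kap i q).
  move=> Uq; have [kNq _] := hk i Uq.
  by rewrite (hopf_corresponds i Uq) (Phi_iso Uq (Neta q Uq) kNq).
have c2 : B (partial i et p) (partial i Yt p) =
    B (partial i eta p) (partial i Y p).
  by rewrite b2 a2 (bk p Up).
have c3 : B (partial i et p) (mixed Yt p) = B (partial i eta p) (mixed Y p).
  rewrite b3 a3 (eq_partial hU (~~ i) Up bk); congr (_ - _).
  have /(congr1 (fun w => B w (kapt i p))) /= -> := D (~~ i).
  by rewrite (hopf_corresponds i Up); exact: Phi_iso.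
have cj j : B (partial i et p) (partial j Yt p) =
    B (partial i eta p) (partial j Y p).
  by case: (i) (j) a1 b1 c2 => -[] //= -> ->.
rewrite -/(et) LE -D (normal_projE _ (Gt Up)) /tangent_proj /frame_proj.
rewrite /coef0 /coef /coefz -!cj -c3 a0 b0.
move: (partial i et p) (Yt p) (partial true Yt p) (partial false Yt p) (mixed Yt p).
by move=> x y y1 y2 z; apply/rowP => j; rewrite !mxE; field.
Qed.

Let gauge_dY i j p : U p -> partial i (partial j Yt) p =
  L p (partial i (partial j Y) p) -
  (if i == j then sg i * ct / 2 else 0) *: Yt p.
Proof.
move=> Up; have [->|ij] := eqVneq i j.
  have [kN ->] := hk j Up; have [_ ->] := hkt j Up.
  rewrite endD endZ (L_Y Up) (spectral_gauge_normal Up kN).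
  rewrite (hopf_corresponds j Up) (hs j Up).
  by move: (Phi p _) (Yt p) => x y; vec.
have -> : j = ~~ i by case: i j ij => -[].
by rewrite (mixedE hU i sYt Up) (mixedE hU i sY Up) (L_mixed Up) scale0r subr0.
Qed.

Let normal_hopf i : normal_section B U Y (kap i).
Proof.
by split=> [|p Up]; [exact: (smooth_hopf hU aY hk)|have [] := hk i Up].
Qed.

Let gauge_dmixed i p : U p -> partial i (mixed Yt) p =
  L p (partial i (mixed Y) p) - (sg i * ct / 2) *: partial (~~ i) Yt p.
Proof.
move=> Up; rewrite (partial_mixed hU aY hk i Up) (partial_mixed hU aYt hkt i Up).
rewrite endD endB !endZ (L_Y Up) (L_dY _ Up) (hs i Up).
rewrite -(gauge_normal_section _ (normal_hopf i) Up).
rewrite (eq_partial hU (f := kapt i) (g := fun q => Phi q (kap i q)) _ Up);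
  last by move=> q; exact: hopf_corresponds.
have -> : partial (~~ i) (st i : R * R -> R^o) p =
    partial (~~ i) (s i : R * R -> R^o) p.
  rewrite (eq_partial hU (g := fun q => s i q + sg i * ct : R^o) _ Up);
    last by move=> q; exact: hs.
  rewrite (partialD _ (smooth_schwarzian hU aY hk i)
    (smooth_cst hU (sg i * ct : R^o)) Up).
  by rewrite partial_cst addr0.
move: (partial (~~ i) (fun q => Phi q (kap i q)) p) (Yt p) (partial _ Yt p).
move=> x y z.
by vec.
Qed.

(** Differentiating the decomposition of [phi] in the two frames, the only terms
    that [L] fails to match are those in the Schwarzians, from [Y_ii] and from
    the derivatives of [Y_uv]; they differ by constants. *)
Lemma spectral_gaugeP : gauge B U minus ct Y Yt spectral_gauge.
Proof.
split; [|exact: spectral_gauge_onto|exact: L_Y|].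
  by move=> p Up x x'; exact: spectral_gauge_isometry.
move=> phi sphi.
have sP i := smooth_partial i sY; have sPt i := smooth_partial i sYt.
have sM := smooth_mixed sY; have sMt := smooth_mixed sYt.
have sB f : smooth_on U f -> smooth_on U (fun q => B (phi q) (f q) : R^o).
  exact: smooth_form.
have sc (c : R) (f : R * R -> R^o) : smooth_on U f ->
    smooth_on U (fun q => c * f q : R^o).
  by move=> sf; apply: smoothM => //; exact: smooth_cst.
(* [phi = eta + tang Y] with [eta] normal, and then [L phi = Phi eta + tang Yt]. *)
pose c0 q : R^o := coef0 (phi q) q.
pose c i q : R^o := coef i (phi q) q.
pose cz q : R^o := coefz (phi q) q.
have s0 : smooth_on U c0.
  apply: (smoothN hU); apply: smoothD => //; first exact: sc (sB _ sM).
  by apply: smoothM; [|apply: sc; apply: smooth_form|exact: sB].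
have si i : smooth_on U (c i) by apply: sc; exact: sB.
have sz : smooth_on U cz by apply: (smoothN hU); apply: sc; exact: sB.
pose eta q := phi q - (c0 q *: Y q + c true q *: partial true Y q +
  c false q *: partial false Y q + cz q *: mixed Y q).
have seta : smooth_on U eta.
  apply: smoothD => //; apply: smoothN => //.
  by do !apply: smoothD => //; apply: smoothZ.
have Eeta q : U q -> eta q = normal_proj B Y q (phi q).
  move=> Uq; rewrite /eta {1}(frame_split (phi q) Uq) -/(c0 q) -!/(c _ q) -/(cz q).
  by move: (normal_proj B Y q (phi q)) => w; vec.
have etaN : normal_section B U Y eta.
  by split=> // q Uq; rewrite (Eeta q Uq); exact: normal_projN.
have [_ par] := hPhi; have [sPe _] := par _ etaN.
pose tang (Z : R * R -> 'rV[R]_m) q := c0 q *: Z q + c true q *: partial true Z q +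
  c false q *: partial false Z q + cz q *: mixed Z q.
have stang Z : smooth_on U Z -> smooth_on U (tang Z).
  move=> sZ; have sPZ j := smooth_partial j sZ; have sMZ := smooth_mixed sZ.
  by do !apply: smoothD => //; apply: smoothZ.
have dtang Z i p : smooth_on U Z -> U p -> partial i (tang Z) p =
    (partial i c0 p *: Z p + partial i (c true) p *: partial true Z p +
     partial i (c false) p *: partial false Z p + partial i cz p *: mixed Z p) +
    (c0 p *: partial i Z p + c true p *: partial i (partial true Z) p +
     c false p *: partial i (partial false Z) p + cz p *: partial i (mixed Z) p).
  move=> sZ Up; have sPZ j := smooth_partial j sZ; have sMZ := smooth_mixed sZ.
  have z0 := smoothZ hU s0 sZ; have z1 := smoothZ hU (si true) (sPZ true).
  have z2 := smoothZ hU (si false) (sPZ false); have z3 := smoothZ hU sz sMZ.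
  have z01 := smoothD hU z0 z1; have z012 := smoothD hU z01 z2.
  rewrite (partialD i z012 z3 Up) (partialD i z01 z2 Up) (partialD i z0 z1 Up).
  rewrite (partialZ i s0 sZ Up) (partialZ i (si true) (sPZ true) Up).
  rewrite (partialZ i (si false) (sPZ false) Up) (partialZ i sz sMZ Up).
  by rewrite [RHS]addrACA; congr (_ + _); rewrite [RHS]addrACA; congr (_ + _);
    rewrite [RHS]addrACA.
have Ephi q : phi q = eta q + tang Y q by rewrite /eta subrK.
have ELphi q : U q -> L q (phi q) = Phi q (eta q) + tang Yt q.
  by move=> Uq; rewrite /tang LE (Eeta q Uq) -!addrA.
split=> [|i p Up].
  apply: (eq_smooth hU _ (smoothD hU sPe (stang _ sYt))) => q Uq.
  by rewrite (ELphi q Uq).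
rewrite (eq_partial hU (g := fun q => Phi q (eta q) + tang Yt q) i Up);
  last exact: ELphi.
rewrite (partialD i sPe (stang _ sYt) Up) (gauge_normal_section i etaN Up).
rewrite (eq_partial hU (f := phi) (g := fun q => eta q + tang Y q) i Up);
  last by move=> q _; exact: Ephi.
rewrite (partialD i seta (stang _ sY) Up) endD -addrA; congr (_ + _).
rewrite (dtang _ _ _ sYt Up) (dtang _ _ _ sY Up).
rewrite !(gauge_dY _ _ Up) (gauge_dmixed _ Up).
rewrite !endD !endZ (L_Y Up) !(L_dY _ Up) (L_mixed Up) -/L.
move: (Yt p) (partial true Yt p) (partial false Yt p) (mixed Yt p).
move: (L p (partial i (mixed Y) p)) (L p (partial i (partial true Y) p)).
move: (L p (partial i (partial false Y) p)).
move: (partial i c0 p) (partial i (c true) p) (partial i (c false) p).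
move: (partial i cz p) => d3 d0 d1 d2 w2 w3 w1 y y1 y2 y3.
rewrite /c0 /c /cz /coef /coefz.
by case: (i); rewrite /=; apply/rowP => j; rewrite !mxE; field.
Qed.

End GaugeConstruction.

(** * Polar surfaces *)

Section PolarSurfaces.
Variables (R : realType) (m : nat) (B : {symmetric 'rV[R]_m}).
Variable U : set (R * R).
Hypothesis hU : open U.
Implicit Types (i : bool) (p : R * R).

Lemma vlineZ (k : R) (v : 'rV[R]_m) : k != 0 -> (<[k *: v]> = <[v]>)%VS.
Proof.
move=> k0; apply/eqP; rewrite eqEsubv -!memvE memvZ ?memv_line//=.
by rewrite -{1}[v](scalerK k0) memvZ// memv_line.
Qed.

Lemma canonical_asymptotic y Y : canonical_lift B U y Y ->
  asymptotic_lift B U 2^-1 Y.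
Proof.
rewrite /canonical_lift partial_uE partial_vE => -[[sY lY] cY].
split; [by rewrite invr_neq0// pnatr_eq0|exact: sY|move=> p Up].
have [_ g0 _] := lY p Up; have [gu gv guv] := cY p Up.
by split=> // -[].
Qed.

Lemma spectral_lifts_gauge minus ct y yt Y Yt :
  (forall x, (forall z, B x z = 0) -> x = 0) ->
  spectral_lifts B U minus ct y yt Y Yt ->
  exists kap s L Phi,
    [/\ asymptotic_lift B U 2^-1 Y,
        hopf_schwarz B U Y kap s /\
          (forall i p, U p -> kap i p = dsign R minus i *: kap true p),
        gauge B U minus ct Y Yt L, parallel_isometry B U Y Yt Phi &
        forall p x, U p -> x \in conf_normal B Y p -> L p x = Phi p x].
Proof.
move=> nondeg [_ _ /canonical_asymptotic aY /canonical_asymptotic aYt].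
case=> k1 [k2 [s1 [s2 [k1t [k2t [s1t [s2t [hk had hkt hs [Phi hPhi hPhik]]]]]]]]].
pose kap i := if i then k1 else k2; pose kapt i := if i then k1t else k2t.
pose s i := if i then s1 else s2; pose st i := if i then s1t else s2t.
have hk' : hopf_schwarz B U Y kap s.
  move: hk; rewrite /conf_invariants partial_uE partial_vE => hk i p Up.
  by have [? ? ? ?] := hk p Up; case: i.
have hkt' : hopf_schwarz B U Yt kapt st.
  move: hkt; rewrite /conf_invariants partial_uE partial_vE => hkt i p Up.
  by have [? ? ? ?] := hkt p Up; case: i.
have hs' i p : U p -> st i p = s i p + dsign R minus i * ct.
  by move=> Up; have [e1 e2] := hs p Up; case: i; rewrite /dsign ?mul1r.
have hPhik' i p x : U p -> x \in conf_normal B Y p ->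
    B (kapt i p) (Phi p x) = B (kap i p) x.
  by move=> Up xN; have [e1 e2] := hPhik p Up x xN; case: i.
exists kap, s, (spectral_gauge B Y Yt Phi), Phi; split.
- exact: aY.
- split=> // i p Up; have := had p Up; rewrite /kap /dsign.
  by case: i => [_|->]; rewrite ?scale1r// scalerA -expr2 sqrr_sign scale1r.
- exact: (spectral_gaugeP nondeg hU aY aYt hk' hkt' hs' hPhi hPhik').
- exact: hPhi.
by move=> p x Up xN; exact: (spectral_gauge_normal hU Yt Phi aY Up xN).
Qed.

Lemma polar_surface_image c Y Yt Phi psi : parallel_isometry B U Y Yt Phi ->
  polar_surface B U c Y psi -> polar_surface B U c Yt (fun q => Phi q (psi q)).
Proof.
move=> [iso par] [psiN hpsi]; have [_ Npsi] := psiN.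
have [sP dP] := par _ psiN.
split=> [|p Up].
  split; first exact: sP.
  by move=> p Up; have [<- _] := iso p Up; exact: memv_img (Npsi p Up).
have [du dv pp] := hpsi p Up; have [-> ->] := dP p Up.
have [_ isop] := iso p Up.
by rewrite du dv linear0 (isop _ _ (Npsi p Up) (Npsi p Up)).
Qed.

Section PolarDerivative.
Variables (minus : bool) (c : R) (Y psi : R * R -> 'rV[R]_m).
Variables (kap : bool -> R * R -> 'rV[R]_m) (s : bool -> R * R -> R).
Hypotheses (aY : asymptotic_lift B U 2^-1 Y) (hk : hopf_schwarz B U Y kap s).
Hypothesis had : forall i p, U p -> kap i p = dsign R minus i *: kap true p.
Hypothesis hpsi : polar_surface B U c Y psi.

Definition polar_factor q : R := B (psi q) (kap true q).
Let f : R * R -> R^o := polar_factor.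

Lemma smooth_polar_factor : smooth_on U f.
Proof.
have [[spsi _] _] := hpsi; apply: smooth_form => //.
exact: (smooth_hopf hU aY hk).
Qed.

(** A parallel section moves inside the tangent frame, so that its derivative
    is determined by its inner products with the Hopf differentials. *)
Lemma polar_derivative i p : U p -> partial i psi p =
  (2 * dsign R minus i) *:
    (partial (~~ i) f p *: Y p - f p *: partial (~~ i) Y p).
Proof.
move=> Up; have [psiN Dpsi] := hpsi; have [spsi _] := psiN.
have G := asymptotic_frame hU aY Up.
have D j : normal_proj B Y p (partial j psi p) = 0.
  have [] := Dpsi p Up; rewrite /D_u /D_v partial_uE partial_vE.
  by case: j.
have [a0 a1 a2] := normal_section_derivative hU aY hk i psiN Up.
have -> : B (normal_proj B Y p (partial (~~ i) psi p)) (kap i p) = 0.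
  by rewrite (D (~~ i)) ip0l.
have fi q : U q -> B (psi q) (kap i q) = dsign R minus i * f q.
  by move=> Uq; rewrite (had i Uq) ipZr.
rewrite (eq_partial hU (g := fun q => dsign R minus i * f q : R^o) _ Up);
  last exact: fi.
rewrite (partialM _ (smooth_cst hU (dsign R minus i : R^o))
  smooth_polar_factor Up).
rewrite partial_cst mul0r add0r => a3.
have := D i; rewrite (normal_projE _ G) => /eqP; rewrite subr_eq0 => /eqP ->.
rewrite /tangent_proj /frame_proj a0 a3.
move: a1 a2; rewrite fi//.
move: (partial i psi p) (f p) (partial (~~ i) f p) (dsign R minus i) => x h h' e.
case: (i) => /= -> ->.
  move: (Y p) (partial true Y p) (partial false Y p) (mixed Y p) => y y1 y2 z.
  by apply/rowP => j; rewrite !mxE; field.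
move: (Y p) (partial true Y p) (partial false Y p) (mixed Y p) => y y1 y2 z.
by apply/rowP => j; rewrite !mxE; field.
Qed.

(** Where the factor vanishes, both derivatives of [psi] are multiples of
    [Y]. *)
Lemma polar_factor_neq0 p : nondegenerate_polar U c psi -> U p -> f p != 0.
Proof.
move=> nd Up; apply/eqP => f0.
have {}nd : free [:: partial true psi p; partial false psi p].
  have := nd p Up; rewrite partial_uE partial_vE.
  by case: (c == 0) => //; rewrite free_cons => /andP[].
move: nd; rewrite !polar_derivative// f0 !scale0r !subr0 !scalerA.
move: (_ * _ * _) (_ * _ * _) => k1 k2.
rewrite free_cons seq1_free span_seq1 => /andP[/negP H].
rewrite scaler_eq0 negb_or => /andP[k20 _].
by apply: H; rewrite (vlineZ _ k20) memvZ// memv_line.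
Qed.

End PolarDerivative.

Lemma polar_spectral minus ct Y Yt L psi (f : R * R -> R)
    (y yt : R * R -> {vspace 'rV[R]_m}) :
  asymptotic_lift B U 2^-1 Y -> gauge B U minus ct Y Yt L ->
  null_polar B U minus Y psi f ->
  (forall p, U p -> y p = <[psi p]>%VS) ->
  (forall p, U p -> yt p = <[L p (psi p)]>%VS) ->
  spectral_transform B U minus ct y yt.
Proof.
move=> aY hL hpsi ypsi ytpsi; have [s [k hX]] := polar_lift_exists hU aY hpsi.
have g0 p : U p -> (2 * f p)^-1 != 0.
  have [_ _ f0 _ _] := hpsi.
  by move=> Up; rewrite invr_neq0// mulf_neq0 ?f0// pnatr_eq0.
apply: (gauge_spectral_transform hU aY hL hX) => p Up.
  by rewrite ypsi// vlineZ// g0.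
by rewrite ytpsi// endZ vlineZ// g0.
Qed.

End PolarSurfaces.

(** * The extended space for surfaces of constant non-zero square norm *)

Section ExtendedSpace.
Variables (R : realType) (m : nat).

Definition ext_emb (x : 'rV[R]_m) : 'rV[R]_(m + 1) := row_mx x 0.

Fact ext_emb_linear : linear ext_emb.
Proof.
by move=> k x y; rewrite /ext_emb scale_row_mx scaler0 add_row_mx addr0.
Qed.

Definition ext_last (t : 'rV[R]_1) : 'rV[R]_(m + 1) := row_mx 0 t.

Fact ext_last_linear : linear ext_last.
Proof.
by move=> k x y; rewrite /ext_last scale_row_mx scaler0 add_row_mx addr0.
Qed.

Section ExtendedEnd.
Variable f : 'End('rV[R]_m).

Definition ext_end_fun (x : 'rV[R]_(m + 1)) : 'rV[R]_(m + 1) :=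
  row_mx (f (lsubmx x)) (rsubmx x).

Fact ext_end_fun_linear : linear ext_end_fun.
Proof.
by move=> k x y; rewrite /ext_end_fun !linearP /= scale_row_mx add_row_mx.
Qed.

HB.instance Definition _ := GRing.isLinear.Build R 'rV[R]_(m + 1)
  'rV[R]_(m + 1) *:%R ext_end_fun ext_end_fun_linear.

Definition ext_end : 'End('rV[R]_(m + 1)) := linfun ext_end_fun.

Lemma ext_endE x : ext_end x = row_mx (f (lsubmx x)) (rsubmx x).
Proof. by rewrite lfunE. Qed.

End ExtendedEnd.

Variables (B : {symmetric 'rV[R]_m}) (c : R) (U : set (R * R)).
Hypothesis hU : open U.
Let B' : {symmetric 'rV[R]_(m + 1)} := ext_form B c.
Implicit Types (i : bool) (p : R * R).

Lemma ext_form_row x y (t t' : 'rV[R]_1) :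
  B' (row_mx x t) (row_mx y t') = B x y - c * (t 0 0 * t' 0 0).
Proof. by rewrite /B' /= /ext_form !row_mxKl !row_mxKr. Qed.

Lemma ext_form_emb x y : B' (ext_emb x) (ext_emb y) = B x y.
Proof. by rewrite ext_form_row !mxE mulr0 mulr0 subr0. Qed.

Lemma ext_form_embr x y : B' x (ext_emb y) = B (lsubmx x) y.
Proof. by rewrite -{1}[x]hsubmxK ext_form_row !mxE mulr0 mulr0 subr0. Qed.

Lemma partial_emb i Y p : smooth_on U Y -> U p ->
  partial i (ext_emb \o Y) p = ext_emb (partial i Y p).
Proof.
have ce := linear_rV_continuous ext_emb_linear.
exact: (partial_linear hU i ext_emb_linear ce).
Qed.

Lemma smooth_emb Y : smooth_on U Y -> smooth_on U (ext_emb \o Y).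
Proof.
exact: (smooth_linear hU ext_emb_linear (linear_rV_continuous ext_emb_linear)).
Qed.

Lemma asymptotic_emb e Y : asymptotic_lift B U e Y ->
  asymptotic_lift B' U e (ext_emb \o Y).
Proof.
move=> [e0 sY gY]; split; [exact: e0|exact: smooth_emb|move=> p Up].
have [g0 gi guv] := gY p Up.
split=> [|i|]; rewrite ?(partial_emb _ sY Up) ext_form_emb; [exact: g0|exact: gi|].
exact: guv.
Qed.

(** The gauge acts trivially on the added direction. *)
Lemma gauge_emb minus ct Y Yt L : asymptotic_lift B U 2^-1 Y ->
  smooth_on U Yt -> gauge B U minus ct Y Yt L ->
  gauge B' U minus ct (ext_emb \o Y) (ext_emb \o Yt) (fun q => ext_end (L q)).
Proof.
move=> [_ sY _] sYt [iso onto LY hd]; split=> [p Up x x'|p Up|p Up|phi sphi].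
- rewrite !ext_endE ext_form_row (iso p Up) -ext_form_row.
  by rewrite !hsubmxK.
- apply/vspaceP => x; rewrite memvf; apply/idP.
  have : lsubmx x \in limg (L p) by rewrite onto// memvf.
  case/memv_imgP => w _ Ew; apply/memv_imgP.
  exists (row_mx w (rsubmx x)); first exact: memvf.
  by rewrite ext_endE row_mxKl row_mxKr -Ew hsubmxK.
- by rewrite ext_endE /= /ext_emb row_mxKl row_mxKr LY.
have ll : linear (lsubmx : 'rV[R]_(m + 1) -> 'rV[R]_m).
  by move=> k x y; exact: linearP.
have lr : linear (rsubmx : 'rV[R]_(m + 1) -> 'rV[R]_1).
  by move=> k x y; exact: linearP.
have cl := linear_rV_continuous ll; have cr := linear_rV_continuous lr.
have ce := linear_rV_continuous ext_last_linear.
have sl := smooth_linear hU ll cl sphi; have sr := smooth_linear hU lr cr sphi.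
have [sL dL] := hd _ sl.
have E q : ext_end (L q) (phi q) =
    ext_emb (L q (lsubmx (phi q))) + ext_last (rsubmx (phi q)).
  by rewrite ext_endE /ext_emb /ext_last add_row_mx addr0 add0r.
have s1 := smooth_emb sL; have s2 := smooth_linear hU ext_last_linear ce sr.
split=> [|i p Up].
  by apply: (eq_smooth hU _ (smoothD hU s1 s2)) => q _; rewrite E.
rewrite (eq_partial hU
  (g := fun q => (ext_emb \o (fun q => L q (lsubmx (phi q)))) q +
    ext_last (rsubmx (phi q))) i Up); last by move=> q _; exact: E.
rewrite (partialD i s1 s2 Up) (partial_emb i sL Up) (dL i p Up).
rewrite (partial_linear hU i ext_last_linear ce sr Up).
rewrite (partial_linear hU i lr cr sphi Up) (partial_linear hU i ll cl sphi Up).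
rewrite (partial_emb _ sY Up) (partial_emb _ sYt Up) !ext_form_embr ext_endE.
rewrite /ext_emb /ext_last !(scale_row_mx, opp_row_mx, add_row_mx).
by rewrite !(scaler0, oppr0, addr0, add0r).
Qed.

(** A polar surface of square norm [c] becomes null once the added direction
    contributes [- c]. *)
Lemma null_polar_emb minus Y psi (f : R * R -> R) :
  asymptotic_lift B U 2^-1 Y -> smooth_on U psi ->
  smooth_on U (f : R * R -> R^o) ->
  (forall p, U p -> f p != 0) ->
  (forall p, U p -> B (psi p) (psi p) = c /\ psi p \in conf_normal B Y p) ->
  (forall i p, U p -> partial i psi p =
     (2 * dsign R minus i) *: (partial (~~ i) (f : R * R -> R^o) p *: Y p -
                               f p *: partial (~~ i) Y p)) ->
  null_polar B' U minus (ext_emb \o Y) (fun p => row_mx (psi p) 1) f.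
Proof.
move=> [_ sY _] spsi sf f0 hpsi dpsi.
have E : (fun p => row_mx (psi p) 1) = (fun p => (ext_emb \o psi) p + ext_last 1).
  by apply/funext => p; rewrite /= /ext_emb /ext_last add_row_mx addr0 add0r.
have sc : smooth_on U (fun=> ext_last 1) by exact: smooth_cst.
have sP i := smooth_partial i sY.
have M p : U p -> mixed (ext_emb \o Y) p = ext_emb (mixed Y p).
  move=> Up; rewrite /mixed.
  rewrite (eq_partial hU (g := ext_emb \o partial false Y) _ Up).
    exact: partial_emb.
  by move=> q Uq; exact: partial_emb.
split=> [|//|//|p Up|i p Up].
- by rewrite E; apply: smoothD => //; exact: smooth_emb.
- have [pp /mem_conf_normal [p0 pi pz]] := hpsi p Up.
  split; first by rewrite ext_form_row pp !mxE eqxx mulr1 mulr1 subrr.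
  apply/mem_conf_normal; split=> [|i|].
  + by rewrite ext_form_embr row_mxKl p0.
  + by rewrite (partial_emb i sY Up) ext_form_embr row_mxKl pi.
  by rewrite (M p Up) ext_form_embr row_mxKl pz.
rewrite E (partialD i (smooth_emb spsi) sc Up) partial_cst addr0.
rewrite (partial_emb i spsi Up) (partial_emb _ sY Up) (dpsi i p Up) /ext_emb.
rewrite !(scale_row_mx, opp_row_mx, add_row_mx).
by rewrite !(scaler0, oppr0, addr0).
Qed.

End ExtendedSpace.

Lemma std_form_nondegenerate (R : realType) (m s : nat) (x : 'rV[R]_m) :
  (forall y, std_form s x y = 0) -> x = 0.
Proof.
move=> H; apply/rowP => j; have := H (delta_mx 0 j).
rewrite /std_form (bigD1 j) //= big1 => [|k kj].
  by rewrite !mxE !eqxx mulr1 addr0 => /eqP; rewrite mulf_eq0; case: ifP => _;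
    rewrite ?oppr_eq0 oner_eq0 /= => /eqP.
by rewrite !mxE eqxx (negPf kj) !mulr0.
Qed.

Theorem theorem5p2 (R : realType) (n r : nat) (hr : (1 <= r)%N)
    (hnr : (r + 2 <= n)%N) (minus : bool) (ct c : R)
    (U : set (R * R)) (hU : open U)
    (y yt : R * R -> {vspace 'rV[R]_(n + 2)})
    (Y Yt : R * R -> 'rV[R]_(n + 2))
    (hy : spectral_lifts (@std_form R (n + 2) (r + 1)) U minus ct y yt Y Yt)
    (psi : R * R -> 'rV[R]_(n + 2))
    (hpsi : polar_surface (@std_form R (n + 2) (r + 1)) U c Y psi)
    (hnd : nondegenerate_polar U c psi) :
  exists psit : R * R -> 'rV[R]_(n + 2),
    polar_surface (@std_form R (n + 2) (r + 1)) U c Yt psit /\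
    polar_spectral_transform (@std_form R (n + 2) (r + 1)) U minus ct c psi psit.
Proof.
set B : {symmetric 'rV[R]_(n + 2)} := @std_form R (n + 2) (r + 1).
have nondeg (x : 'rV[R]_(n + 2)) : (forall z, B x z = 0) -> x = 0.
  exact: std_form_nondegenerate.
have [kap [s [L [Phi [aY [hk had] hL hPhi LPhi]]]]] :=
  spectral_lifts_gauge hU nondeg hy.
have psiN p : U p -> psi p \in conf_normal B Y p.
  by case: hpsi => -[_ +] _; exact.
have psi_psi p : U p -> B (psi p) (psi p) = c.
  by case: hpsi => _ + Up => /(_ p Up) [].
have spsi : smooth_on U psi by case: hpsi => -[].
pose f : R * R -> R^o := polar_factor B psi kap.
have sf : smooth_on U f := smooth_polar_factor hU aY hk hpsi.
have f0 p : U p -> f p != 0.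
  exact: (polar_factor_neq0 hU aY hk had hpsi hnd).
have dpsi := polar_derivative hU aY hk had hpsi.
have sYt : smooth_on U Yt by have [_ _ _ [[]]] := hy.
exists (fun q => Phi q (psi q)); split.
  exact: polar_surface_image hPhi hpsi.
rewrite /polar_spectral_transform; case: eqP => [c0|_].
  have N : null_polar B U minus Y psi f.
    by split=> // p Up; split; [rewrite psi_psi|exact: psiN].
  apply: (polar_spectral hU aY hL N) => [//|p Up].
  by rewrite /proj_map (LPhi p _ Up (psiN p Up)).
have N := null_polar_emb (minus := minus) hU aY spsi sf f0
  (fun p Up => conj (psi_psi p Up) (psiN p Up)) dpsi.
apply: (polar_spectral hU (asymptotic_emb c hU aY)
  (gauge_emb c hU aY sYt hL) N) => [//|p Up].
by rewrite /proj_map ext_endE row_mxKl row_mxKr (LPhi p _ Up (psiN p Up)).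
Qed.
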